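(* Let $X$ be a Čech-complete topological group and $Y$ be any topological group. Every universally measurable homomorphism $h:X\to Y$ is continuous.
   Context: A Tychonoff space is Čech-complete if it is homeomorphic to a $G_\delta$-subset of some compact Hausdorff space; a topological group is Čech-complete if its underlying space is. A probability Radon measure on a Tychonoff space $X$ is a $\sigma$-additive measure $\mu$ on the Borel $\sigma$-algebra of $X$ with $\mu(X)=1$ such that for every Borel $B$ and every $a<\mu(B)$ there is a compact $K\subseteq B$ with $\mu(K)>a$. A set $A\subseteq X$ is universally measurable if it is $\mu$-measurable for every probability Radon measure $\mu$ on $X$ (i.e. there are Borel sets $B\subseteq A\subseteq B'$ with $\mu(B'\setminus B)=0$). A function $f:X\to Y$ is universally measurable if $f^{-1}[U]$ is universally measurable for every open $U\subseteq Y$. *)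

(* Defs.v *)
From HB Require Import structures.
From mathcomp Require Import all_boot all_order all_algebra.
From mathcomp Require Import all_classical all_reals all_analysis borel_hierarchy.
Set Implicit Arguments. Unset Strict Implicit. Unset Printing Implicit Defensive.
Import Order.TTheory GRing.Theory Num.Theory.
Local Open Scope classical_set_scope.
Local Open Scope ring_scope.

Definition topological_group (G : topologicalType)
    (mul : G -> G -> G) (inv : G -> G) (one : G) : Prop :=
  [/\ forall x y z, mul x (mul y z) = mul (mul x y) z,
      forall x, mul one x = x /\ mul x one = x,
      forall x, mul (inv x) x = one /\ mul x (inv x) = one,
      continuous (fun p : G * G => mul p.1 p.2) &
      continuous inv].

Definition embedding (X K : topologicalType) (e : X -> K) : Prop :=
  [/\ injective e, continuous e &
      forall U : set X, open U ->
        exists2 V : set K, open V & e @` U = V `&` range e].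

(* Čech-complete: homeomorphic to a G_delta subset of a compact Hausdorff
   space (such a space is automatically Tychonoff). *)
Definition cech_complete (X : topologicalType) : Prop :=
  exists (K : topologicalType) (e : X -> K),
    [/\ compact [set: K], hausdorff_space K, embedding e & Gdelta (range e)].

Definition borel (X : topologicalType) (A : set X) : Prop :=
  <<s [set U : set X | open U] >> A.

Definition prob_radon_measure (R : realType) (X : topologicalType)
    (mu : set X -> \bar R) : Prop :=
  [/\ forall B, borel B -> (0 <= mu B)%E,
      mu set0 = 0%E,
      (forall F : (set X)^nat, (forall n, borel (F n)) -> trivIset setT F ->
         (fun n => (\sum_(0 <= i < n) mu (F i))%E) @ \oo --> mu (\bigcup_n F n)),
      mu setT = 1%E &
      forall B, borel B -> forall a : \bar R, (a < mu B)%E ->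
        exists K : set X, [/\ compact K, K `<=` B & (a < mu K)%E]].

Definition mu_measurable (R : realType) (X : topologicalType)
    (mu : set X -> \bar R) (A : set X) : Prop :=
  exists B B' : set X,
    [/\ borel B, borel B', B `<=` A, A `<=` B' & mu (B' `\` B) = 0%E].

Definition universally_measurable_set (R : realType) (X : topologicalType)
    (A : set X) : Prop :=
  forall mu : set X -> \bar R, prob_radon_measure mu -> mu_measurable mu A.

Definition universally_measurable_fun (R : realType) (X Y : topologicalType)
    (f : X -> Y) : Prop :=
  forall U : set Y, open U -> universally_measurable_set R (f @^-1` U).

(* Main.v *)
Require Import Defs.
From HB Require Import structures.
From mathcomp Require Import all_boot all_order all_algebra.
From mathcomp Require Import all_classical all_reals all_analysis.
From mathcomp Require Import lra zify wochoice.

(* Suppose [h] is universally measurable.  If elements [f n] of [X] tend to the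
   identity fast enough, the products ... [f 2]^(e 2) [f 1]^(e 1) [f 0]^(e 0)
   with [e] in the Cantor space exist modulo a compact subgroup on which [h] is
   small, and they carry a Radon measure lifting the coin-tossing measure.  A
   set of the form [h^-1 (y V)] of positive measure contains, by a Steinhaus
   argument, two products that differ in a single bit [e n]; comparing them
   shows that [h (t^-1 (f n) t)] is in [V^-1 V] for some partial product [t] of
   [f 0], ..., [f (n - 1)].  This is a game that a fast sequence cannot win.
   Playing it against a nowhere dense [h^-1 V] shows that the closure of
   [h^-1 V] is a neighbourhood of the identity for every [V].  If [h] were
   discontinuous, this density would allow one to choose [f n] tending to the
   identity with [h (f n)] so close to [h (f 0)], which is far from the
   identity, that all conjugates [t^-1 (f n) t] are far as well, which wins the
   game: contradiction.

   That some [h^-1 (y V)] has positive measure is not obvious, because [Y] need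
   not be separable.  Stone's theorem on the paracompactness of metric spaces
   gives a family of uniformly separated small open sets, any union of which
   has a measurable preimage.  If all of them had null preimages, one could
   split repeatedly and get a Cantor set on which every subset is measurable,
   which a parity set contradicts.  On compact subgroups, which need not be
   metrizable, this splitting may fail; there one argues with Haar measure and
   Vitali's method: translates of a union of cells are disjoint. *)

Set Implicit Arguments. Unset Strict Implicit. Unset Printing Implicit Defensive.
Import Order.TTheory GRing.Theory Num.Theory.
Import numFieldNormedType.Exports.
Local Open Scope classical_set_scope.
Local Open Scope ring_scope.

(** * Compact Hausdorff spaces *)

Lemma eq_set0P T (A : set T) x : A = set0 -> A x -> False.
Proof. by move=> ->. Qed.

Section Compactness.
Context {X : topologicalType}.

Lemma filter_seq (I : eqType) (T : Type) (F : set_system T) (s : seq I)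
    (U : I -> set T) : Filter F ->
  (forall i, i \in s -> F (U i)) -> F [set z | forall i, i \in s -> U i z].
Proof.
move=> FF; elim: s => [|a s IH] FU.
  by apply: (@filterS _ F _ setT) => //; exact: filterT.
have Fa : F (U a) by apply: FU; rewrite inE eqxx.
have {}IH : F [set z | forall i, i \in s -> U i z].
  by apply: IH => i si; apply: FU; rewrite inE si orbT.
apply: filterS2 Fa IH => z /= Uaz Uz i.
by rewrite inE => /orP[/eqP->|/Uz].
Qed.

Lemma compact_finite_cover (K : set X) (N : X -> set X) :
  compact K -> (forall x, K x -> nbhs x (N x)) ->
  exists s : seq X, (forall x, x \in s -> K x) /\
    forall y, K y -> exists2 x, x \in s & N x y.
Proof.
move=> cK NK.
(* [F] consists of the properties of all sufficiently large finite lists, ordered by inclusion;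
   near-covering compactness along this filter produces one list that serves every point. *)
pose F := [set Q : set (seq X) | exists s0 : seq X,
  forall s, {subset s0 <= s} -> Q s].
have FF : Filter F.
  split; first by exists [::].
  - move=> P Q [s Ps] [t Qt]; exists (s ++ t) => u su; split.
      by apply: Ps => x xs; apply: su; rewrite mem_cat xs.
    by apply: Qt => x xs; apply: su; rewrite mem_cat xs orbT.
  - by move=> P Q PQ [s Ps]; exists s => u /Ps /PQ.
pose P (s : seq X) y := exists2 x, (x \in s) /\ K x & N x y.
have /compact_near_coveringP/(_ _ F P FF) : compact K by [].
case.
  move=> x Kx; exists (N x, [set s : seq X | x \in s]) => /=.
    split; first exact: NK.
    by exists [:: x] => s; apply; rewrite inE.
  by move=> [y s] /= [Ny xs]; exists x.
move=> s0 /(_ s0) sP; exists [seq x <- s0 | `[< K x >]]; split.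
  by move=> x; rewrite mem_filter => /andP[/asboolP].
move=> y Ky; have [//|x [xs Kx] Nx] := sP _ y Ky.
by exists x => //; rewrite mem_filter xs andbT; exact/asboolP.
Qed.

Hypothesis hX : hausdorff_space X.

Lemma compact_separate_point (L : set X) (x : X) : compact L -> ~ L x ->
  exists2 W, nbhs x W & closure W `&` L = set0.
Proof.
move=> cL Lx.
have H y : exists UV : set X * set X, L y ->
    [/\ nbhs x UV.1, open UV.2, UV.2 y & UV.1 `&` UV.2 = set0].
  have [Ly|nLy] := pselect (L y); last by exists (setT, setT).
  have xy : x != y by apply/eqP => xy; apply: Lx; rewrite xy.
  move: hX; rewrite open_hausdorff => /(_ x y xy) [[A B] /=].
  rewrite !inE => -[Ax By] [oA oB AB]; exists (A, B) => _; split => //.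
    exact: open_nbhs_nbhs.
have {H} [UV HUV] := choice H.
have [s [sL Lcov]] : exists s : seq X, (forall y, y \in s -> L y) /\
    forall z, L z -> exists2 y, y \in s & (UV y).2 z.
  apply: compact_finite_cover => // y Ly; have [_ oV Vy _] := HUV y Ly.
  exact: open_nbhs_nbhs.
exists [set z | forall y, y \in s -> (UV y).1 z].
  by apply: filter_seq => y /sL /HUV[].
rewrite -subset0 => z [clz Lz].
have [y ys Vz] := Lcov z Lz.
have [_ oV _ dUV] := HUV y (sL y ys).
have [t [Wt Vt]] := clz _ (open_nbhs_nbhs (conj oV Vz)).
by apply: (eq_set0P (x := t) dUV); split => //; exact: Wt.
Qed.

Lemma closed_seq (I : eqType) (s : seq I) (F : I -> set X) :
  (forall i, i \in s -> closed (F i)) ->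
  closed [set x | exists2 i, i \in s & F i x].
Proof.
elim: s => [|a s IH] cF.
  rewrite (_ : [set _ | _] = set0); first exact: closed0.
  by rewrite -subset0 => x [].
rewrite (_ : [set _ | _] = F a `|` [set x | exists2 i, i \in s & F i x]).
  apply: closedU; first by apply: cF; rewrite inE eqxx.
  by apply: IH => i si; apply: cF; rewrite inE si orbT.
apply/seteqP; split => x /=.
  move=> [i]; rewrite inE => /orP[/eqP->|si Fi]; first by left.
  by right; exists i.
move=> [Fa|[i si Fi]]; first by exists a; rewrite ?inE ?eqxx.
by exists i; rewrite ?inE ?si ?orbT.
Qed.

Lemma compact_separate (K L : set X) : compact K -> compact L ->
  K `&` L = set0 -> exists U V, [/\ open U, open V, K `<=` U, L `<=` V &
    U `&` V = set0].
Proof.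
move=> cK cL KL.
have H x : exists W : set X, K x -> nbhs x W /\ closure W `&` L = set0.
  have [Kx|nKx] := pselect (K x); last by exists setT.
  have nLx : ~ L x by move=> Lx; rewrite -[False]/(set0 x) -KL.
  by have [W Wx WL] := compact_separate_point cL nLx; exists W.
have {H} [W HW] := choice H.
have [s [sK Kcov]] : exists s : seq X, (forall y, y \in s -> K y) /\
    forall z, K z -> exists2 y, y \in s & (W y)° z.
  by apply: compact_finite_cover => // x Kx; apply/nbhs_interior; exact: (HW x Kx).1.
have cC : closed [set z | exists2 x, x \in s & closure (W x) z].
  by apply: closed_seq => x _; exact: closed_closure.
exists (\bigcup_(x in [set` s]) (W x)°).
exists (~` [set z | exists2 x, x \in s & closure (W x) z]); split.
- by apply: bigcup_open => x _; exact: open_interior.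
- exact: closed_openC.
- by move=> x /Kcov [y ys Wy]; exists y.
- move=> y Ly [x xs clx]; have [_ WL] := HW x (sK x xs).
  by apply: (eq_set0P (x := y) WL).
- rewrite -subset0 => x [[y ys Wyx]] /=; apply; exists y => //.
  by apply: subset_closure; exact: interior_subset.
Qed.

(** The parts of [K] outside [U] and outside [V] are disjoint compact sets; deleting disjoint open
    neighbourhoods of them from [K], one at a time, gives the two pieces. *)
Lemma compact_split (K U V : set X) : compact K -> open U -> open V ->
  K `<=` U `|` V -> exists L M, [/\ compact L, compact M, L `<=` U, M `<=` V &
    K = L `|` M].
Proof.
move=> cK oU oV KUV.
have cl : closed K by exact: compact_closed.
have cKD W : open W -> compact (K `\` W).
  move=> oW; apply: (subclosed_compact _ cK); last exact: subDsetl.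
  by apply: closedI => //; exact: open_closedC.
have [|U' [V' [oU' oV' sU sV dUV]]] :=
  compact_separate (cKD _ oU) (cKD _ oV).
  by rewrite -subset0 => x [[Kx Ux] [_ Vx]]; case: (KUV x Kx).
exists (K `\` U'), (K `\` V'); split.
- exact: cKD.
- exact: cKD.
- by move=> x [Kx U'x]; apply: contrapT => nUx; apply: U'x; apply: sU.
- by move=> x [Kx V'x]; apply: contrapT => nVx; apply: V'x; apply: sV.
- apply/seteqP; split => x; last by move=> [[]|[]].
  move=> Kx; have [U'x|] := pselect (U' x); last by left.
  right; split => // V'x.
  by apply: (eq_set0P (x := x) dUV).
Qed.
End Compactness.

(** * Radon measures from contents *)

Section Borel.
Context {X : topologicalType}.

Lemma borel_open (U : set X) : open U -> borel U.
Proof. by move=> oU; apply: sub_sigma_algebra. Qed.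

Lemma borelC (A : set X) : borel A -> borel (~` A).
Proof.
move=> bA; rewrite -setTD.
by have [_ + _] := smallest_sigma_algebra setT [set U : set X | open U]; exact.
Qed.

Lemma borel_bigcup (F : nat -> set X) :
  (forall n, borel (F n)) -> borel (\bigcup_n F n).
Proof.
by have [_ _] := smallest_sigma_algebra setT [set U : set X | open U]; exact.
Qed.

Lemma borelU (A B : set X) : borel A -> borel B -> borel (A `|` B).
Proof.
move=> bA bB; rewrite -bigcup2E; apply: borel_bigcup => -[|[|n]] //=.
by apply: borel_open; exact: open0.
Qed.

Lemma borelI (A B : set X) : borel A -> borel B -> borel (A `&` B).
Proof.
move=> bA bB; rewrite -[A `&` B]setCK setCI.
by apply: borelC; apply: borelU; exact: borelC.
Qed.

Lemma borelD (A B : set X) : borel A -> borel B -> borel (A `\` B).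
Proof. by move=> bA bB; rewrite setDE; apply: borelI => //; exact: borelC. Qed.

Lemma borel_closed (A : set X) : closed A -> borel A.
Proof.
by move=> cA; rewrite -[A]setCK; apply: borelC; apply: borel_open; exact: closed_openC.
Qed.

End Borel.

(** The measure is kept as a real-valued outer measure on all subsets, so that monotonicity and
    subadditivity apply without measurability conditions. In [ro_bigcup] geometric weights replace
    infinite sums. *)
Record radon_outer (R : realType) (X : topologicalType) (m : set X -> R) : Prop :=
  RadonOuter {
  ro_prob : prob_radon_measure (fun A => (m A)%:E);
  ro_set0 : m set0 = 0;
  ro_ge0 : forall A, 0 <= m A;
  ro_le : forall A B, A `<=` B -> m A <= m B;
  ro_setU : forall A B, m (A `|` B) <= m A + m B;
  ro_bigcup : forall (F : nat -> set X) a,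
    (forall n, m (F n) <= a / (2 ^ n.+1)%:R) -> m (\bigcup_n F n) <= a;
  ro_cara : forall B, borel B -> forall A, m A = m (A `&` B) + m (A `\` B);
  ro_setT : m setT = 1;
  ro_inner : forall B a, borel B -> a < m B ->
    exists K, [/\ compact K, K `<=` B & a < m K];
  ro_outer : forall A a, m A < a -> exists U, [/\ open U, A `<=` U & m U < a] }.

Section Content.
Context {R : realType} {X : topologicalType}.
Hypothesis hX : hausdorff_space X.
Variables (k : set X -> R) (C : set X).
Hypothesis k_ge0 : forall K, compact K -> 0 <= k K.
Hypothesis k_le : forall K L, compact K -> compact L -> K `<=` L -> k K <= k L.
Hypothesis kU : forall K L, compact K -> compact L -> k (K `|` L) <= k K + k L.
Hypothesis kUd : forall K L, compact K -> compact L -> K `&` L = set0 ->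
  k K + k L <= k (K `|` L).
Hypothesis k_le1 : forall K, compact K -> k K <= 1.
Hypothesis cC : compact C.
Hypothesis kC : k C = 1.

Let k0 : k set0 = 0.
Proof.
have c0 := @compact0 X.
have := kUd c0 c0 (set0I _); rewrite setU0; have := k_ge0 c0; lra.
Qed.

(** Halmos's construction: a content on compact sets yields an inner content on open sets, then the
    outer measure [content_outer], to which Carathéodory's criterion applies. *)
Definition inner_content (U : set X) : R :=
  sup [set k K | K in [set K | compact K /\ K `<=` U]].
Local Notation inn := inner_content.

Let innP U : has_sup [set k K | K in [set K | compact K /\ K `<=` U]].
Proof.
split.
  by exists (k set0), set0 => //; split; [exact: compact0|exact: sub0set].
by exists 1 => _ [K [cK _] <-]; exact: k_le1.
Qed.

Lemma inner_content_ge U K : compact K -> K `<=` U -> k K <= inn U.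
Proof. by move=> cK KU; apply: ub_le_sup; [case: (innP U)|exists K]. Qed.

Lemma inner_content_le U a :
  (forall K, compact K -> K `<=` U -> k K <= a) -> inn U <= a.
Proof.
move=> H; apply: ge_sup; first by case: (innP U).
by move=> _ [K [cK KU] <-]; exact: H.
Qed.

Lemma inner_content_ge0 U : 0 <= inn U.
Proof. by rewrite -k0; apply: inner_content_ge; [exact: compact0|exact: sub0set]. Qed.

Lemma inner_content_le1 U : inn U <= 1.
Proof. by apply: inner_content_le => K cK _; exact: k_le1. Qed.

Lemma inner_contentS U V : U `<=` V -> inn U <= inn V.
Proof.
move=> UV; apply: inner_content_le => K cK KU.
by apply: inner_content_ge => //; exact: subset_trans UV.
Qed.

Lemma inner_contentU U V : open U -> open V -> inn (U `|` V) <= inn U + inn V.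
Proof.
move=> oU oV; apply: inner_content_le => K cK KUV.
have [L [M [cL cM LU MV ->]]] := compact_split hX cK oU oV KUV.
by apply: le_trans (kU cL cM) _; apply: lerD; exact: inner_content_ge.
Qed.

Lemma inner_content_bigsetU (U : nat -> set X) n : (forall i, open (U i)) ->
  open (\big[setU/set0]_(i < n) U i) /\
  inn (\big[setU/set0]_(i < n) U i) <= \sum_(i < n) inn (U i).
Proof.
move=> oU; elim: n => [|n [oB IH]].
  rewrite !big_ord0; split; first exact: open0.
  by apply: inner_content_le => K _; rewrite subset0 => ->; rewrite k0.
rewrite !big_ord_recr /=; split; first exact: openU.
by apply: le_trans (inner_contentU _ _) _ => //; rewrite lerD2r.
Qed.

(** Compactness reduces countable subadditivity of the inner content to the finite case. *)
Lemma inner_content_bigcup (U : nat -> set X) : (forall i, open (U i)) ->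
  forall K, compact K -> K `<=` \bigcup_i U i ->
  exists n, k K <= \sum_(i < n) inn (U i).
Proof.
move=> oU K cK KU.
have /compact_near_coveringP/(_ nat \oo
  (fun n x => (\big[setU/set0]_(i < n) U i) x)) := cK.
case.
  move=> x /KU [i _ Uix]; exists (U i, [set n | (i < n)%N]) => /=.
    split; first by apply: open_nbhs_nbhs.
    exact: nbhs_infty_gt.
  move=> [y n] /= [Uy ni]; rewrite -bigcup_mkord.
  by exists i.
move=> n _ /(_ n (leqnn n)) /= Kn; exists n.
have [oB le] := inner_content_bigsetU n oU.
by apply: le_trans le; exact: inner_content_ge.
Qed.

Definition content_outer (A : set X) : R :=
  inf [set inn U | U in [set U | open U /\ A `<=` U]].
Local Notation out := content_outer.

Let outP A : has_inf [set inn U | U in [set U | open U /\ A `<=` U]].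
Proof.
split; first by exists (inn setT), setT => //; split => //; exact: openT.
by exists 0 => _ [U _ <-]; exact: inner_content_ge0.
Qed.

Lemma content_outer_le A U : open U -> A `<=` U -> out A <= inn U.
Proof. by move=> oU AU; apply: ge_inf; [case: (outP A)|exists U]. Qed.

Lemma content_outer_ge A a :
  (forall U, open U -> A `<=` U -> a <= inn U) -> a <= out A.
Proof.
move=> H; apply: lb_le_inf; first by case: (outP A).
by move=> _ [U [oU AU] <-]; exact: H.
Qed.

Lemma content_outer_lt A a : out A < a ->
  exists U, [/\ open U, A `<=` U & inn U < a].
Proof.
move=> aU; apply: contrapT => H.
have : a <= out A; last by rewrite leNgt aU.
apply: content_outer_ge => U oU AU; rewrite leNgt; apply/negP => aK.
by apply: H; exists U.
Qed.

Lemma content_outer_open U : open U -> out U = inn U.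
Proof.
move=> oU; apply/eqP; rewrite eq_le; apply/andP; split.
  exact: content_outer_le.
by apply: content_outer_ge => V oV; exact: inner_contentS.
Qed.

Lemma content_outer_compact K : compact K -> k K <= out K.
Proof.
by move=> cK; apply: content_outer_ge => U oU; exact: inner_content_ge.
Qed.

Let out_ge0 A : 0 <= out A.
Proof. by apply: content_outer_ge => U _ _; exact: inner_content_ge0. Qed.

Let out_le A B : A `<=` B -> out A <= out B.
Proof.
move=> AB; apply: content_outer_ge => U oU BU.
by apply: content_outer_le => //; exact: subset_trans BU.
Qed.

Let out0 : out set0 = 0.
Proof.
apply/eqP; rewrite eq_le out_ge0 andbT content_outer_open; last exact: open0.
by apply: inner_content_le => K _; rewrite subset0 => ->; rewrite k0.
Qed.

Let outT : out setT = 1.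
Proof.
apply/eqP; rewrite eq_le content_outer_open; last exact: openT.
by rewrite inner_content_le1 /= -kC; exact: inner_content_ge.
Qed.

Definition content_measure (A : set X) : \bar R := (out A)%:E.
Local Notation mu := content_measure.

Local Open Scope ereal_scope.
Let mu0 : mu set0 = 0. Proof. by rewrite /mu out0. Qed.
Let mu_ge0 A : 0 <= mu A. Proof. by rewrite lee_fin. Qed.
Let mu_le : {homo mu : A B / A `<=` B >-> A <= B}.
Proof. by move=> A B AB; rewrite lee_fin out_le. Qed.

Let mu_ssub : sigma_subadditive mu.
Proof.
move=> F; apply/lee_addgt0Pr => e e0.
apply: le_trans (epsilon_trick xpredT _ (ltW e0)); last by move=> n; exact: mu_ge0.
have H n : exists U, [/\ open U, F n `<=` U & (inn U < out (F n) + e / (2 ^ n.+1)%:R)%R].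
  by apply: content_outer_lt; rewrite ltrDl divr_gt0// ltr0n expn_gt0.
have {H} [U HU] := choice H.
have oU n : open (U n) by case: (HU n).
apply: (@le_trans _ _ (inn (\bigcup_n U n))%:E).
  rewrite lee_fin; apply: content_outer_le; first exact: bigcup_open.
  by apply: subset_bigcup => n _; case: (HU n).
have pos n : 0 <= mu (F n) + (e / (2 ^ n.+1)%:R)%:E.
  by apply: adde_ge0 => //; rewrite lee_fin divr_ge0// ltW.
have key K : compact K -> K `<=` \bigcup_n U n ->
    (k K)%:E <= \sum_(0 <= i <oo) (mu (F i) + (e / (2 ^ i.+1)%:R)%:E).
  move=> cK KU; have [n kn] := inner_content_bigcup oU cK KU.
  apply: le_trans (nneseries_lim_ge n _); last by move=> i _ _; exact: pos.
  rewrite big_mkord; under eq_bigr do rewrite -EFinD.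
  rewrite sumEFin lee_fin; apply: le_trans kn _.
  by apply: ler_sum => i _; case: (HU i) => _ _ /ltW.
have := @nneseries_ge0 R _ xpredT 0 (fun n _ _ => pos n).
case E : (\sum_(0 <= i <oo) _) => [r| |] // _; last by rewrite leey.
rewrite lee_fin; apply: inner_content_le => K cK KU.
by have := key K cK KU; rewrite E lee_fin.
Qed.

HB.instance Definition _ := isOuterMeasure.Build R X mu mu0 mu_ge0 mu_le mu_ssub.

(** For an open [W] around [A], approximate the part of [W] in [U] by a compact [K] from inside, and
    then [W] minus [K] by a compact [L]. As [K] and [L] are disjoint, their contents add up to at
    most that of [W]. *)
Let open_cara U : open U -> mu.-caratheodory U.
Proof.
move=> oU; apply: le_caratheodory_measurable => A; rewrite -EFinD lee_fin.
apply: content_outer_ge => W oW AW.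
rewrite -lerBrDr.
apply: (@le_trans _ _ (inn (W `&` U))).
  by apply: content_outer_le; [exact: openI|exact: setSI].
apply: inner_content_le => K cK KWU; rewrite lerBrDr.
have oWK : open (W `\` K).
  by apply: openI => //; apply: closed_openC; exact: compact_closed.
apply: (@le_trans _ _ (k K + inn (W `\` K))%R).
  rewrite lerD2l; apply: content_outer_le => //.
  by move=> x [Ax nUx]; split; [exact: AW|move=> /KWU[]].
rewrite -lerBrDl; apply: inner_content_le => L cL LWK; rewrite lerBrDl.
apply: le_trans (kUd cK cL _) _.
  by rewrite -subset0 => x [Kx /LWK[]].
apply: inner_content_ge; first exact: compactU.
by move=> x [/KWU[]|/LWK[]].
Qed.

Let borel_cara A : borel A -> mu.-caratheodory A.
Proof.
apply: smallest_sub; last by move=> U; exact: open_cara.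
split.
- exact: caratheodory_measurable_set0.
- by move=> B MB; rewrite setTD; exact: caratheodory_measurable_setC.
- by move=> F MF; exact: caratheodory_measurable_bigcup.
Qed.

Let mu_sadd (F : nat -> set X) : (forall n, borel (F n)) -> trivIset setT F ->
  (fun n => \sum_(0 <= i < n) mu (F i)) @ \oo --> mu (\bigcup_n F n).
Proof.
move=> bF tF.
have MF n : mu.-caratheodory (F n) by exact: borel_cara.
have pos n : xpredT n -> 0 <= mu (F n) by [].
have -> : mu (\bigcup_n F n) = \sum_(0 <= n <oo) mu (F n).
  apply/eqP; rewrite eq_le; apply/andP; split; first exact: mu_ssub.
  have := caratheodory_lime_le MF tF (\bigcup_n F n).
  rewrite setICr outer_measure0 adde0.
  rewrite (_ : (fun n => _) = fun n => \sum_(0 <= k < n) mu (F k))//.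
  apply/funext => n; apply: eq_bigr => i _; congr mu.
  by rewrite setIC; apply/setIidPl; exact: bigcup_sup.
by apply: is_cvg_nneseries => n _ _; exact: mu_ge0.
Qed.
Local Close Scope ereal_scope.

Let out_cara B : borel B -> forall A, out A = out (A `&` B) + out (A `\` B).
Proof.
by move=> /borel_cara MB A; have := MB A; rewrite /mu -EFinD setDE => -[].
Qed.

Lemma content_outer_radon : radon_outer out.
Proof.
have inner B a : borel B -> a < out B ->
    exists K, [/\ compact K, K `<=` B & a < out K].
  move=> bB aB.
  (* Inner regularity comes from outer regularity of the complement: an open set around the
     complement of [B] is removed from the compact set [C], which has full measure. *)
  have : out (~` B) < 1 - a.
    by have := out_cara bB setT; rewrite setTI setTD outT; lra.
  move=> /content_outer_lt [U [oU BU Ua]].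
  exists (C `\` U); split.
  - apply: (subclosed_compact _ cC); last exact: subDsetl.
    apply: closedI; last exact: open_closedC.
    exact: compact_closed.
  - by move=> x [_ nUx]; apply: contrapT => /BU.
  - have := out_cara (borel_open oU) C.
    have : out (C `&` U) <= out U by apply: out_le; exact: subIsetr.
    have := content_outer_compact cC; rewrite kC (content_outer_open oU).
    by lra.
split => //.
- split.
  + by move=> B _; rewrite lee_fin.
  + by rewrite out0.
  + exact: mu_sadd.
  + by rewrite outT.
  + move=> B bB [r| |] //; last first.
      by move=> _; exists set0; split; [exact: compact0|exact: sub0set|rewrite ltNye].
    by rewrite lte_fin => /(inner B r bB) [K [cK KB rK]]; exists K; rewrite lte_fin.
- move=> A B; rewrite -lee_fin EFinD; exact: (outer_measureU2 content_measure).
- move=> F a HF.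
  have a0 : 0 <= a.
    by have := le_trans (out_ge0 _) (HF 0%N); rewrite pmulr_lge0// invr_gt0 ltr0n.
  rewrite -lee_fin; apply: (le_trans (mu_ssub F)).
  apply: le_trans (epsilon_trick0 xpredT a0).
  by apply: lee_nneseries => // n _; rewrite lee_fin.
- move=> A a /content_outer_lt [U [oU AU Ua]].
  by exists U; rewrite content_outer_open.
Qed.

End Content.

(** * Limits along ultrafilters and topological groups *)

Section ContentInvariance.
Context {R : realType} {X : topologicalType}.
Variables (k : set X -> R).
Hypothesis k_ge0 : forall K, compact K -> 0 <= k K.
Hypothesis kUd : forall K L, compact K -> compact L -> K `&` L = set0 ->
  k K + k L <= k (K `|` L).
Hypothesis k_le1 : forall K, compact K -> k K <= 1.
Variables (f g : X -> X).
Hypotheses (fK : cancel f g) (gK : cancel g f).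
Hypotheses (cf : continuous f) (cg : continuous g).
Hypothesis kf : forall K, compact K -> k (f @^-1` K) = k K.

(** Applied to a map and to its inverse, the inequality becomes the equality used for Haar
    measure. *)
Lemma content_outer_preimage_le (A : set X) :
  content_outer k (f @^-1` A) <= content_outer k A.
Proof.
apply: content_outer_ge => // U oU AU.
apply: (@le_trans _ _ (inner_content k (f @^-1` U))).
  apply: content_outer_le => //; last exact: preimage_subset.
  by apply: open_comp => // x _; exact: cf.
apply: inner_content_le => // K cK KU.
have E : g @^-1` K = f @` K.
  apply/seteqP; split => x /=; first by move=> Kg; exists (g x).
  by move=> [y Ky <-]; rewrite fK.
have cgK : compact (g @^-1` K).
  by rewrite E; apply: continuous_compact => //; exact: continuous_subspaceT.
have <- : k (g @^-1` K) = k K.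
  rewrite -(kf cgK); congr k.
  by apply/seteqP; split => x /=; rewrite fK.
apply: inner_content_ge => // x /= /KU; by rewrite /= gK.
Qed.
End ContentInvariance.

Section UltraLimit.
Context {R : realType} {T : Type} {G : set_system T} {UG : UltraFilter G}.

Definition ulim (f : T -> R) : R := lim (f @ G).

(** Compactness of the interval gives a cluster point, and a cluster point of an ultrafilter is a
    limit. *)
Lemma ulim_cvg (f : T -> R) a b : (forall t, a <= f t <= b) ->
  f @ G --> ulim f.
Proof.
move=> fab.
have Gab : (f @ G) `[a, b]%classic.
  rewrite /= nbhs_filterE; apply: (@filterE _ G) => t.
  by rewrite /= in_itv /=; exact: fab.
have [p [_ clp]] := @segment_compact R a b (f @ G) _ Gab.
have cv : f @ G --> p.
  move=> A pA; have [//|GA] := in_ultra_setVsetC (f @^-1` A) UG.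
  by have [t [nAt /nAt]] := clp (~` A) A GA pA.
by rewrite /ulim (cvg_lim _ cv).
Qed.

Lemma ulim_le (f g : T -> R) a b c d : (forall t, a <= f t <= b) ->
  (forall t, c <= g t <= d) -> (\forall t \near G, f t <= g t) ->
  ulim f <= ulim g.
Proof.
move=> fab gcd fg.
rewrite -subr_ge0.
apply: (cvgr_to_ge (cvgB (ulim_cvg gcd) (ulim_cvg fab))).
by apply: filterS fg => t; rewrite subr_ge0.
Qed.

Lemma ulimD (f g : T -> R) a b c d : (forall t, a <= f t <= b) ->
  (forall t, c <= g t <= d) -> ulim (fun t => f t + g t) = ulim f + ulim g.
Proof.
move=> fab gcd; apply: cvg_lim => //.
by apply: cvgD; [exact: ulim_cvg fab|exact: ulim_cvg gcd].
Qed.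

Lemma ulim_cst (c : R) : ulim (fun _ => c) = c.
Proof. exact: lim_cst. Qed.

Lemma ulim_ge0le1 (f : T -> R) : (forall t, 0 <= f t <= 1) -> 0 <= ulim f <= 1.
Proof.
move=> f01; have c (x : R) (t : T) : x <= x <= x by rewrite lexx.
have c0 := ulim_le (c 0) f01; have c1 := ulim_le f01 (c 1).
rewrite !ulim_cst in c0 c1; rewrite c0 ?c1//; apply: filterE => t;
  by case/andP: (f01 t).
Qed.

End UltraLimit.
Arguments ulim {R T} G f.

(** * Bundled topological groups and their calculus *)

Record topgroup := TopGroup {
  tg_sort :> topologicalType;
  tg_mul : tg_sort -> tg_sort -> tg_sort;
  tg_inv : tg_sort -> tg_sort;
  tg_one : tg_sort;
  tg_ax : topological_group tg_mul tg_inv tg_one }.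

Notation "x ** y" := (tg_mul x y) (at level 40, left associativity).
Notation "x ^v" := (tg_inv x) (at level 3, left associativity, format "x ^v").
Notation "\e" := (tg_one _).

Section GroupTheory.
Context {X : topgroup}.
Implicit Types x y z : X.

Lemma tmulA x y z : x ** y ** z = x ** (y ** z).
Proof. by case: X x y z => T m i e [H ? ? ? ?] x y z /=; rewrite H. Qed.
Lemma tmul1 x : \e ** x = x.
Proof. by case: X x => T m i e [/= _ H _ _ _] x; case: (H x). Qed.
Lemma tmulr1 x : x ** \e = x.
Proof. by case: X x => T m i e [/= _ H _ _ _] x; case: (H x). Qed.
Lemma tmulV x : x^v ** x = \e.
Proof. by case: X x => T m i e [/= _ _ H _ _] x; case: (H x). Qed.
Lemma tmulrV x : x ** x^v = \e.
Proof. by case: X x => T m i e [/= _ _ H _ _] x; case: (H x). Qed.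
Lemma tmulVK x y : x^v ** (x ** y) = y.
Proof. by rewrite -tmulA tmulV tmul1. Qed.
Lemma tmulKV x y : x ** (x^v ** y) = y.
Proof. by rewrite -tmulA tmulrV tmul1. Qed.
Lemma tinv_uniq x y : x ** y = \e -> y = x^v.
Proof. by move=> xy; rewrite -(tmulVK x y) xy tmulr1. Qed.
Lemma tinvK x : x^v^v = x.
Proof. by apply/esym/tinv_uniq; rewrite tmulV. Qed.
Lemma tinvM x y : (x ** y)^v = y^v ** x^v.
Proof. by apply/esym/tinv_uniq; rewrite tmulA tmulKV tmulrV. Qed.
Lemma tinv1 : (\e : X)^v = \e.
Proof. by apply/esym/tinv_uniq; rewrite tmul1. Qed.

(** Rewriting with these rules normalises group words: products associate to the right, inverses
    move to the letters, and adjacent inverse letters cancel. *)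
Definition tgE := (tmulA, tmul1, tmulr1, tmulV, tmulrV, tmulVK, tmulKV,
  tinvK, tinvM, tinv1).

Lemma tmulI x y z : x ** y = x ** z -> y = z.
Proof. by move=> xyz; rewrite -(tmulVK x y) xyz tmulVK. Qed.

Lemma tmul_cts : continuous (fun p : X * X => p.1 ** p.2).
Proof. by case: X => T m i e [/= _ _ _ H _]. Qed.
Lemma tinv_cts : continuous (@tg_inv X).
Proof. by case: X => T m i e [/= _ _ _ _ H]. Qed.

Lemma cvgtM (T : Type) (F : set_system T) (FF : Filter F) (f g : T -> X) x y :
  f @ F --> x -> g @ F --> y -> (fun t => f t ** g t) @ F --> x ** y.
Proof.
move=> fx gy.
have H := @tmul_cts (x, y).
apply: (@cvg_comp2 _ _ _ _ F (nbhs x) (nbhs y) (nbhs (x ** y)) _ _ _ f g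
  (@tg_mul X) fx gy).
exact: H.
Qed.
End GroupTheory.

Section GroupTopology.
Context {X : topgroup}.

Lemma cvgtV (T : Type) (F : set_system T) (FF : Filter F) (f : T -> X) x :
  f @ F --> x -> (fun t => (f t)^v) @ F --> x^v.
Proof.
by move=> fx; apply: (@cvg_comp _ _ _ f (@tg_inv X) _ _ _ fx); exact: tinv_cts.
Qed.

Lemma cvgt_id (x : X) : (fun y : X => y) @ x --> x. Proof. exact: cvg_id. Qed.

Lemma cvgt_cst (T : Type) (F : set_system T) (FF : Filter F) (x : X) :
  (fun _ : T => x) @ F --> x.
Proof. exact: cvg_cst. Qed.

Lemma cvgt_fst (T : Type) (F : set_system T) (FF : Filter F) (x : X) :
  (fun p : X * T => p.1) @ (nbhs x, F) --> x.
Proof. exact: cvg_fst. Qed.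

Lemma cvgt_snd (T : Type) (F : set_system T) (FF : Filter F) (x : X) :
  (fun p : T * X => p.2) @ (F, nbhs x) --> x.
Proof. exact: cvg_snd. Qed.

End GroupTopology.

(** Derives the convergence of a group word from that of its letters. The limit must be written as
    the same word, hence limits such as [k ** \e] that are simplified only afterwards. *)
Ltac tcvg := repeat first
  [ exact: cvgt_id | exact: cvgt_fst | exact: cvgt_snd | exact: cvgt_cst
  | apply: cvgtM | apply: cvgtV ].

Section GroupTopology2.
Context {X : topgroup}.

Lemma nbhs1_div (U : set X) : nbhs (\e : X) U ->
  exists2 W, nbhs (\e : X) W & forall a b, W a -> W b -> U (a^v ** b).
Proof.
move=> U1.
have H : (fun p : X * X => p.1^v ** p.2) @ (nbhs (\e : X), nbhs (\e : X)) -->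
    (\e : X)^v ** \e by tcvg.
rewrite !tgE in H; have [[A B] /= [A1 B1] AB] := H U U1.
exists (A `&` B); first exact: filterI.
by move=> a b [Aa _] [_ Bb]; exact: (AB (a, b)).
Qed.

Lemma tmul_l_cts (a : X) : continuous (fun x => a ** x).
Proof. by move=> x; tcvg. Qed.

Lemma tmul_r_cts (a : X) : continuous (fun x => x ** a).
Proof. by move=> x; tcvg. Qed.

End GroupTopology2.

(** * Haar measure of a compact subgroup *)

Lemma tube (X : topologicalType) (T : Type) (F : set_system T) (FF : Filter F)
    (K : set X) (P : T -> X -> Prop) : compact K ->
  (forall k, K k -> \forall k' \near k & w \near F, P w k') ->
  \forall w \near F, forall k, K k -> P w k.
Proof. by move=> /compact_near_coveringP cK; exact: cK. Qed.

Section Haar.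
Context {R : realType} {X : topgroup}.
Hypothesis hX : hausdorff_space X.

Definition covers_by (U K : set X) (n : nat) : Prop :=
  exists s : seq X, size s = n /\ forall y, K y -> exists2 x, x \in s & U (x^v ** y).

Lemma covers_by_ex (U K : set X) : nbhs \e U -> compact K ->
  exists n, covers_by U K n.
Proof.
move=> U1 cK.
have [|s [_ sK]] := @compact_finite_cover X K (fun x y => U (x^v ** y)) cK.
  move=> x _; have : (fun y => x^v ** y) @ x --> x^v ** x by tcvg.
  by rewrite tmulV; exact.
by exists (size s), s.
Qed.

(** Haar's covering index of [K] by left translates of [U]; 0 is the default if there is no finite
    cover. *)
Definition cov_num (U K : set X) : nat :=
  if pselect (exists n, `[< covers_by U K n >]) is left e then ex_minn e else 0%N.

Lemma cov_num_min (U K : set X) n : covers_by U K n -> (cov_num U K <= n)%N.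
Proof.
move=> H; rewrite /cov_num; case: pselect => [e|//].
by case: ex_minnP => m _; apply; exact/asboolP.
Qed.

Lemma cov_numP (U K : set X) : nbhs \e U -> compact K ->
  covers_by U K (cov_num U K).
Proof.
move=> U1 cK; have [n Hn] := covers_by_ex U1 cK.
rewrite /cov_num; case: pselect => [e|]; last first.
  by case; exists n; exact/asboolP.
by case: ex_minnP => m /asboolP.
Qed.

Lemma cov_numS (U K L : set X) : nbhs \e U -> compact L -> K `<=` L ->
  (cov_num U K <= cov_num U L)%N.
Proof.
move=> U1 cL KL; have [s [ss sL]] := cov_numP U1 cL.
by apply: cov_num_min; exists s; split => // y /KL /sL.
Qed.

Lemma cov_numU (U K L : set X) : nbhs \e U -> compact K -> compact L ->
  (cov_num U (K `|` L) <= cov_num U K + cov_num U L)%N.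
Proof.
move=> U1 cK cL; have [s [ss sK]] := cov_numP U1 cK.
have [t [st tL]] := cov_numP U1 cL.
apply: cov_num_min; exists (s ++ t); split; first by rewrite size_cat ss st.
move=> y [/sK|/tL] [x xs Ux]; exists x => //; by rewrite mem_cat xs ?orbT.
Qed.

Lemma cov_num_shiftl (g : X) (U K : set X) : nbhs \e U -> compact K ->
  (cov_num U [set y | K (g ** y)] <= cov_num U K)%N.
Proof.
move=> U1 cK; have [s [ss sK]] := cov_numP U1 cK.
apply: cov_num_min; exists [seq g^v ** x | x <- s]; split.
  by rewrite size_map.
move=> y /= /sK [x xs Ux]; exists (g^v ** x); first exact: map_f.
by rewrite !tgE in Ux *.
Qed.

(** Invariance of [U] under conjugation by [g] makes a right shift of a left translate of [U] lie in
    a left translate again. *)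
Lemma cov_num_shiftr (g : X) (U K : set X) : nbhs \e U -> compact K ->
  (forall z, U z -> U (g ** z ** g^v)) ->
  (cov_num U [set y | K (y ** g)] <= cov_num U K)%N.
Proof.
move=> U1 cK Ug; have [s [ss sK]] := cov_numP U1 cK.
apply: cov_num_min; exists [seq x ** g^v | x <- s]; split.
  by rewrite size_map.
move=> y /= /sK [x xs Ux]; exists (x ** g^v); first exact: map_f.
by have := Ug _ Ux; rewrite !tgE.
Qed.

(** No left translate of a small [W] meets both [K] and [L], so a cover of the union splits into the
    translates that meet [K], which cover [K], and the others, which cover [L]. *)
Lemma cov_num_disj (K L : set X) : compact K -> compact L -> K `&` L = set0 ->
  \forall W \near powerset_filter_from (nbhs (\e : X)), nbhs \e W ->
    (cov_num W K + cov_num W L <= cov_num W (K `|` L))%N.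
Proof.
move=> cK cL KL.
have [U [V [oU _ KU LV UV]]] := compact_separate hX cK cL KL.
have : \forall w \near (\e : X), forall k, K k -> U (k ** w).
  apply: (@tube _ _ _ _ _ (fun w k => U (k ** w))) => // k Kk.
  have H : (fun p : X * X => p.1 ** p.2) @ (nbhs k, nbhs (\e : X)) --> k ** \e.
    by tcvg.
  by apply: H; rewrite tmulr1; apply: open_nbhs_nbhs; split => //; exact: KU.
move=> /nbhs1_div [W0 W01 HW0].
near=> W => W1.
have WW0 : W `<=` W0 by near: W; exact: small_set_sub.
have [s [<- sKL]] := cov_numP W1 (compactU cK cL).
pose p x := `[< exists2 k, K k & W (x^v ** k) >].
rewrite -(count_predC p s) -!size_filter; apply: leq_add; apply: cov_num_min.
  exists [seq x <- s | p x]; split=> // y Ky.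
  have [|x xs Wx] := sKL y; first by left.
  by exists x => //; rewrite mem_filter xs andbT; apply/asboolP; exists y.
exists [seq x <- s | predC p x]; split=> // y Ly.
have [|x xs Wx] := sKL y; first by right.
exists x => //; rewrite mem_filter xs andbT; apply/asboolP => -[k Kk Wk].
have := HW0 _ _ (WW0 _ Wk) (WW0 _ Wx) k Kk; rewrite !tgE => Uy.
by apply: (eq_set0P (x := y) UV); split => //; exact: LV.
Unshelve. all: by end_near. Qed.

Variable H : set X.
Hypothesis cH : compact H.
Hypothesis H1 : H \e.
Hypothesis HM : forall x y, H x -> H y -> H (x ** y).
Hypothesis HV : forall x, H x -> H x^v.

(** The largest subset of [U] invariant under conjugation by [H]. Covering by its translates gives
    indices that are invariant on both sides, and thus a two-sided Haar measure. *)
Definition conj_core (U : set X) : set X := [set z | forall g, H g -> U (g ** z ** g^v)].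

Lemma conj_core_nbhs U : nbhs \e U -> nbhs \e (conj_core U).
Proof.
move=> U1; apply: (@tube _ _ _ _ _ (fun w k => U (k ** w ** k^v))) => // k Kk.
have h : (fun p : X * X => p.1 ** p.2 ** p.1^v) @ (nbhs k, nbhs (\e : X)) -->
    k ** \e ** k^v by tcvg.
by apply: h; rewrite tmulr1 tmulrV.
Qed.

Lemma conj_core_sub U : conj_core U `<=` U.
Proof. by move=> z /(_ _ H1); rewrite !tgE. Qed.

Lemma conj_core_conj U g z : H g -> conj_core U z -> conj_core U (g ** z ** g^v).
Proof.
move=> Hg Uz k Hk; have := Uz _ (HM Hk Hg); by rewrite !tgE.
Qed.

Definition cov_ratio (K U : set X) : R :=
  if `[< nbhs \e U >] then
    (cov_num (conj_core U) (K `&` H))%:R / (cov_num (conj_core U) H)%:R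
  else 0.

Let clH : closed H. Proof. exact: compact_closed. Qed.
Let cHK K : compact K -> compact (K `&` H).
Proof. by move=> cK; apply: compact_closedI. Qed.

Let cov_num_gt0 U : nbhs \e U -> (0 < cov_num (conj_core U) H)%N.
Proof.
move=> /conj_core_nbhs U1; rewrite lt0n; apply/eqP => E.
by have [[|x s] [+ /(_ _ H1) []]] := cov_numP U1 cH; rewrite ?E.
Qed.

Lemma cov_ratio01 K U : compact K -> 0 <= cov_ratio K U <= 1.
Proof.
move=> cK; rewrite /cov_ratio; case: asboolP => [U1|_]; last by rewrite lexx ler01.
rewrite divr_ge0//= ler_pdivrMr ?ltr0n ?cov_num_gt0// mul1r ler_nat.
by apply: cov_numS => //; exact: conj_core_nbhs.
Qed.

(** An ultrafilter of ever smaller neighbourhoods of the identity. Along it the covering ratios have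
    a limit, and by [cov_num_disj] this limit is additive on disjoint compact sets. *)
Let Gex := ultraFilterLemma (powerset_filter_from_filter (nbhs_pfilter (\e : X))).
Let G := projT1 (cid Gex).
Let UG : UltraFilter G. Proof. exact: (projT2 (cid Gex)).1. Qed.
Let subG : powerset_filter_from (nbhs (\e : X)) `<=` G.
Proof. exact: (projT2 (cid Gex)).2. Qed.
Existing Instance UG.

Let near_nbhs1 : \forall U \near G, nbhs (\e : X) U.
Proof. by apply: subG; exact: near_small_set. Qed.

Definition haar_content (K : set X) : R := ulim G (cov_ratio K).

Let k01 K : compact K -> 0 <= haar_content K <= 1.
Proof. by move=> cK; apply: ulim_ge0le1 => U; exact: cov_ratio01. Qed.

Let k_le K L : compact K -> compact L -> K `<=` L ->
  haar_content K <= haar_content L.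
Proof.
move=> cK cL KL; apply: (ulim_le (fun U => cov_ratio01 U cK) (fun U => cov_ratio01 U cL)).
apply: filterE => U; rewrite /cov_ratio; case: asboolP => // U1.
rewrite ler_pM2r ?invr_gt0 ?ltr0n ?cov_num_gt0// ler_nat.
by apply: cov_numS; [exact: conj_core_nbhs|exact: cHK|exact: setSI].
Qed.

Let kU K L : compact K -> compact L ->
  haar_content (K `|` L) <= haar_content K + haar_content L.
Proof.
move=> cK cL.
rewrite /haar_content -(ulimD (fun U => cov_ratio01 U cK) (fun U => cov_ratio01 U cL)).
have b U : 0 <= cov_ratio K U + cov_ratio L U <= 2.
  by have := cov_ratio01 U cK; have := cov_ratio01 U cL; lra.
apply: (ulim_le (fun U => cov_ratio01 U (compactU cK cL)) b).
apply: filterE => U; rewrite /cov_ratio; case: asboolP => [U1|]; last by rewrite addr0.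
rewrite -mulrDl ler_pM2r ?invr_gt0 ?ltr0n ?cov_num_gt0// -natrD ler_nat setIUl.
by apply: cov_numU; [exact: conj_core_nbhs|exact: cHK|exact: cHK].
Qed.

Let kUd K L : compact K -> compact L -> K `&` L = set0 ->
  haar_content K + haar_content L <= haar_content (K `|` L).
Proof.
move=> cK cL KL.
rewrite /haar_content -(ulimD (fun U => cov_ratio01 U cK) (fun U => cov_ratio01 U cL)).
have b U : 0 <= cov_ratio K U + cov_ratio L U <= 2.
  by have := cov_ratio01 U cK; have := cov_ratio01 U cL; lra.
apply: (ulim_le b (fun U => cov_ratio01 U (compactU cK cL))).
have dKL : (K `&` H) `&` (L `&` H) = set0 by rewrite setIACA KL set0I.
have [M [Mnbhs Mdown [W MW]] subM] := cov_num_disj (cHK cK) (cHK cL) dKL.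
have : \forall U \near G, U `<=` W.
  by apply: subG; apply: small_set_sub; exact: Mnbhs.
apply: filterS2 near_nbhs1 => U U1 UW; rewrite /cov_ratio; case: asboolP => // _.
rewrite -mulrDl ler_pM2r ?invr_gt0 ?ltr0n ?cov_num_gt0// -natrD ler_nat setIUl.
have U1' := conj_core_nbhs U1.
apply: (subM (conj_core U)) => //; apply: (Mdown W) => //.
by apply: subset_trans UW; exact: conj_core_sub.
Qed.

Let kH : haar_content H = 1.
Proof.
have c (x : R) (t : set X) : x <= x <= x by rewrite lexx.
have [_ h1] := andP (k01 cH); apply/eqP; rewrite eq_le h1 /=.
rewrite -[leLHS](@ulim_cst _ _ G UG); apply: (ulim_le (c 1) (fun U => cov_ratio01 U cH)).
apply: filterS near_nbhs1 => U U1; rewrite /cov_ratio; case: asboolP => // _.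
by rewrite setIid divff// pnatr_eq0 -lt0n cov_num_gt0.
Qed.

Let Hshiftl g K : H g -> [set y | K (g ** y)] `&` H = [set y | (K `&` H) (g ** y)].
Proof.
move=> Hg; apply/seteqP; split => y [] /= Ky Hy; split => //; first exact: HM.
by have := HM (HV Hg) Hy; rewrite !tgE.
Qed.

Let Hshiftr g K : H g -> [set y | K (y ** g)] `&` H = [set y | (K `&` H) (y ** g)].
Proof.
move=> Hg; apply/seteqP; split => y [] /= Ky Hy; split => //; first exact: HM.
by have := HM Hy (HV Hg); rewrite !tgE.
Qed.

Let shiftl_compact g (K : set X) : compact K -> compact [set y | K (g ** y)].
Proof.
move=> cK; rewrite (_ : [set _ | _] = tg_mul g^v @` K).
  apply: continuous_compact => //; apply: continuous_subspaceT.
  exact: tmul_l_cts.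
apply/seteqP; split => y /=; first by exists (g ** y); rewrite ?tgE.
by move=> [x Kx <-]; rewrite !tgE.
Qed.

Let shiftr_compact g (K : set X) : compact K -> compact [set y | K (y ** g)].
Proof.
move=> cK; rewrite (_ : [set _ | _] = (fun x : X => x ** g^v) @` K).
  apply: continuous_compact => //; apply: continuous_subspaceT.
  exact: tmul_r_cts.
apply/seteqP; split => y /=; first by exists (y ** g); rewrite ?tgE.
by move=> [x Kx <-]; rewrite !tgE.
Qed.

Let k_eq (K L : set X) : compact K -> compact L ->
  (forall U, nbhs (\e : X) U ->
    cov_num (conj_core U) (K `&` H) = cov_num (conj_core U) (L `&` H)) ->
  haar_content K = haar_content L.
Proof.
move=> cK cL KL; congr ulim; apply/funext => U; rewrite /cov_ratio.
by case: asboolP => // /KL ->.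
Qed.

Let k_shiftl g K : H g -> compact K -> haar_content [set y | K (g ** y)] = haar_content K.
Proof.
move=> Hg cK; apply: k_eq => // [|U /conj_core_nbhs U1]; first exact: shiftl_compact.
rewrite Hshiftl//; apply/eqP; rewrite eqn_leq cov_num_shiftl//; last exact: cHK.
have := cov_num_shiftl g^v U1 (shiftl_compact (g := g) (cHK cK)).
congr (_ <= _)%N; congr cov_num.
by apply/funext => y /=; rewrite !tgE.
Qed.

Let k_shiftr g K : H g -> compact K -> haar_content [set y | K (y ** g)] = haar_content K.
Proof.
move=> Hg cK; apply: k_eq => // [|U /conj_core_nbhs U1]; first exact: shiftr_compact.
rewrite Hshiftr//; apply/eqP; rewrite eqn_leq cov_num_shiftr//; first last.
- by move=> z; exact: conj_core_conj.
- exact: cHK.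
have := cov_num_shiftr (g := g^v) U1 (shiftr_compact (g := g) (cHK cK)).
rewrite (_ : [set y | _] = K `&` H); last first.
  by apply/funext => y /=; rewrite !tgE.
apply; move=> z; apply: conj_core_conj; exact: HV.
Qed.

Theorem haar_measure : exists m : set X -> R, [/\ radon_outer m, m H = 1,
  forall g A, H g -> m [set y | A (g ** y)] = m A &
  forall g A, H g -> m [set y | A (y ** g)] = m A].
Proof.
have k_ge0 K : compact K -> 0 <= haar_content K by move=> /k01 /andP[].
have k_le1 K : compact K -> haar_content K <= 1 by move=> /k01 /andP[].
have rm := content_outer_radon hX k_ge0 kU kUd k_le1 cH kH.
exists (content_outer haar_content); split => //.
- apply/eqP; rewrite eq_le -{1}(ro_setT rm) (ro_le rm)//=.
  by rewrite -kH content_outer_compact.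
- have le g A : H g -> content_outer haar_content [set y | A (g ** y)] <=
      content_outer haar_content A.
    move=> Hg; apply: (@content_outer_preimage_le _ _ _ k_ge0 kUd k_le1
      (tg_mul g) (tg_mul g^v)) => //.
    + by move=> x; rewrite !tgE.
    + by move=> x; rewrite !tgE.
    + exact: tmul_l_cts.
    + by move=> K; exact: k_shiftl.
  move=> g A Hg; apply/eqP; rewrite eq_le le//=.
  have := le g^v [set y | A (g ** y)] (HV Hg).
  by under eq_fun do rewrite /= !tgE.
- have le g A : H g -> content_outer haar_content [set y | A (y ** g)] <=
      content_outer haar_content A.
    move=> Hg; apply: (@content_outer_preimage_le _ _ _ k_ge0 kUd k_le1
      (fun x : X => x ** g) (fun x : X => x ** g^v)) => //.
    + by move=> x; rewrite !tgE.
    + by move=> x; rewrite !tgE.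
    + exact: tmul_r_cts.
    + by move=> K; exact: k_shiftr.
  move=> g A Hg; apply/eqP; rewrite eq_le le//=.
  have := le g^v [set y | A (y ** g)] (HV Hg).
  by under eq_fun do rewrite /= !tgE.
Qed.

End Haar.

(** * Chains of neighbourhoods and Stone's decomposition *)

Section Chains.
Context {Y : topgroup}.

(** A substitute for the balls of radius [2^-n] of a left-invariant pseudometric. *)
Definition nbhs_chain (V : nat -> set Y) : Prop :=
  [/\ forall n, open (V n), forall n, V n \e, forall n a, V n a -> V n a^v &
      forall n a b, V n.+1 a -> V n.+1 b -> V n (a ** b)].

Lemma nbhs1_square (U : set Y) : nbhs \e U -> exists W,
  [/\ open W, W \e, forall a, W a -> W a^v, forall a b, W a -> W b -> U (a ** b) &
      W `<=` U].
Proof.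
move=> U1; have [W0 W01 HW] := nbhs1_div U1.
pose W := W0° `&` [set a | W0° a^v].
have W1 : W0° (\e : Y) by exact: nbhs_singleton (nbhs_interior _).
have sWU a b : W a -> W b -> U (a ** b).
  move=> [_ Wa] [Wb _]; rewrite -[a]tinvK; apply: HW; exact: interior_subset.
have We : W \e by split => //=; rewrite tinv1.
exists W; split => //.
- apply: openI; first exact: open_interior.
  by apply: open_comp (open_interior W0) => x _; exact: tinv_cts.
- by move=> a [Wa Wa']; split => //=; rewrite tinvK.
- by move=> a Wa; rewrite -[a]tmulr1; exact: sWU.
Qed.

Lemma nbhs_chain_below (U : nat -> set Y) : (forall n, nbhs \e (U n)) ->
  exists2 V, nbhs_chain V & forall n, V n `<=` U n.
Proof.
move=> U1.
have H (U' : set Y) : exists W, nbhs \e U' -> [/\ open W, W \e,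
    forall a, W a -> W a^v, forall a b, W a -> W b -> U' (a ** b) & W `<=` U'].
  have [/nbhs1_square [W HW]|nU] := pselect (nbhs \e U'); last by exists setT.
  by exists W.
have {H} [F HF] := choice H.
pose V := fix V n := F (if n is n'.+1 then V n' `&` U n else U n).
have V1 n : nbhs \e (V n).
  elim: n => [|n IH] /=.
    by have [oW We _ _ _] := HF _ (U1 0%N); exact: open_nbhs_nbhs.
  by have [oW We _ _ _] := HF _ (filterI IH (U1 n.+1)); exact: open_nbhs_nbhs.
pose pre n := if n is n'.+1 then V n' `&` U n else U n.
have pre1 n : nbhs \e (pre n) by case: n => [|n] //=; exact: filterI.
have VE n : V n = F (pre n) by case: n.
exists V; first split=> n.
- by rewrite VE; have [] := HF _ (pre1 n).
- by rewrite VE; have [] := HF _ (pre1 n).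
- by rewrite VE; have [] := HF _ (pre1 n).
- by move=> a b; rewrite VE => Va Vb; have [_ _ _ /(_ a b Va Vb) []] := HF _ (pre1 n.+1).
move=> n; rewrite VE; have [_ _ _ _ sub] := HF _ (pre1 n).
by apply: subset_trans sub _; case: n => [|n] //=; exact: subIsetr.
Qed.

Lemma nbhs_chain_ex (U : set Y) : nbhs \e U ->
  exists2 V, nbhs_chain V & V 0%N `<=` U.
Proof.
by move=> U1; have [V cV VU] := nbhs_chain_below (fun=> U1); exists V.
Qed.

Variable V : nat -> set Y.
Hypothesis cV : nbhs_chain V.

Lemma chain_open n : open (V n). Proof. by case: cV. Qed.
Lemma chain1 n : V n \e. Proof. by case: cV. Qed.
Lemma chainV n a : V n a -> V n a^v. Proof. by case: cV => _ _ + _; apply. Qed.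
Lemma chainM n a b : V n.+1 a -> V n.+1 b -> V n (a ** b).
Proof. by case: cV => _ _ _; apply. Qed.
Lemma chainS n : V n.+1 `<=` V n.
Proof. by move=> a Va; rewrite -[a]tmulr1; apply: chainM => //; exact: chain1. Qed.
Lemma chain_le m n : (m <= n)%N -> V n `<=` V m.
Proof.
move=> /subnK <-; elim: (n - m)%N => [|k IH] //=; rewrite addSn.
exact: subset_trans (@chainS _) IH.
Qed.
Lemma chain_nbhs n : nbhs \e (V n).
Proof. by apply: open_nbhs_nbhs; split; [exact: chain_open|exact: chain1]. Qed.
Lemma chain_add k : nbhs_chain (fun i => V (i + k)%N).
Proof.
split=> [i|i|i a|i a b]; [exact: chain_open|exact: chain1|exact: chainV|].
by rewrite addSn; exact: chainM.
Qed.

(* The increasing sets [stone_ball n] stay inside [V 0], while each of them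
   is separated from the complement of the next one. *)
Fixpoint stone_ball (n : nat) : set Y :=
  if n is n'.+1 then [set z | exists b v, [/\ stone_ball n' b, V n'.+2 v & z = b ** v]]
  else V 1.

(** The product telescopes from the right: the last two factors combine into one element of the
    preceding neighbourhood. *)
Lemma stone_ballM n b v : stone_ball n b -> V n.+1 v -> V 0%N (b ** v).
Proof.
elim: n b v => [|n IH] b v /=; first exact: chainM.
move=> [b' [v' [Bb Vv ->]]] Vv'; rewrite tmulA; apply: IH => //.
exact: chainM.
Qed.

Lemma stone_ball_sub n : stone_ball n `<=` V 0%N.
Proof. by move=> b Bb; rewrite -[b]tmulr1; apply: (stone_ballM Bb); exact: chain1. Qed.

Let wo := well_ordering_principle Y.
Let wo_lt (s' s : Y) : Prop := projT1 wo s' s /\ s' <> s.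

Definition stone_piece (Gam : set Y) n (s : Y) : set Y :=
  [set y | (exists2 g, Gam g & stone_ball n ((g ** s)^v ** y)) /\
    forall s' g m, wo_lt s' s -> Gam g -> ~ stone_ball m ((g ** s')^v ** y)].

Lemma stone_piece_cover Gam y : Gam \e -> exists n s, stone_piece Gam n s y.
Proof.
move=> G1.
pose A : {pred Y} := fun s => `[< exists g m, Gam g /\ stone_ball m ((g ** s)^v ** y) >].
have Ay : nonempty A.
  exists y; rewrite unfold_in; apply/asboolP; exists \e, 0%N; split => //=.
  by rewrite !tgE; exact: chain1.
have [s [[]]] := projT2 wo A Ay; rewrite unfold_in => /asboolP [g [n [Gg Bn]]] low _.
exists n, s; split; first by exists g.
move=> s' g' m [s's ne] Gg' Bm; apply: ne.
have As' : s' \in A by rewrite unfold_in; apply/asboolP; exists g', m.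
have Rss' := low s' As'.
(* Antisymmetry of the order follows from the uniqueness of the least element of a pair. *)
pose P : {pred Y} := fun z => (z == s) || (z == s').
have [|z [_ zu]] := projT2 wo P; first by exists s; rewrite unfold_in eqxx.
have Rxx x : projT1 wo x x.
  have [|w [[]]] := projT2 wo (pred1 x); first by exists x; rewrite inE.
  by rewrite inE => /eqP -> /(_ x); rewrite inE eqxx => /(_ isT).
transitivity z; [apply: esym|]; apply: zu; split; rewrite ?unfold_in ?eqxx ?orbT//.
  by move=> t; rewrite unfold_in => /orP[/eqP ->|/eqP ->].
by move=> t; rewrite unfold_in => /orP[/eqP ->|/eqP ->].
Qed.

(** If one centre preceded the other, the point of the later piece would lie in ball [n.+1] of the
    earlier centre, which its own piece forbids. *)
Lemma stone_piece_sep Gam n s s' y y' : stone_piece Gam n s y ->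
  stone_piece Gam n s' y' -> V n.+2 (y^v ** y') -> s = s'.
Proof.
have main t t' z z' : stone_piece Gam n t z -> stone_piece Gam n t' z' ->
    V n.+2 (z^v ** z') -> ~ wo_lt t t'.
  move=> [[g Gg Bg] _] [_ Ht'] Vz lt; apply: (Ht' t g n.+1 lt Gg).
  exists ((g ** t)^v ** z), (z^v ** z'); split => //.
  by rewrite !tgE.
move=> Ey Ey' Vy; apply: contrapT => ne.
have n1 := main _ _ _ _ Ey Ey' Vy.
have n2 : ~ wo_lt s' s by apply: main Ey' Ey _; have := chainV Vy; rewrite !tgE.
pose P : {pred Y} := fun z => (z == s) || (z == s').
have [|z [[]]] := projT2 wo P; first by exists s; rewrite unfold_in eqxx.
rewrite unfold_in => /orP[] /eqP -> low _.
  by apply: n1; split => //; apply: low; rewrite unfold_in eqxx orbT.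
by apply: n2; split; [apply: low; rewrite unfold_in eqxx|exact: nesym].
Qed.

End Chains.

(** * Consequences of Radon regularity *)

Section RadonOuter.
Context {R : realType} {X : topologicalType} {m : set X -> R}.
Hypothesis rm : radon_outer m.

Lemma radon_bigcup_count (I : countType) (F : I -> set X) :
  (forall i, m (F i) = 0) -> m (\bigcup_i F i) = 0.
Proof.
move=> F0; apply/eqP; rewrite eq_le (ro_ge0 rm) andbT.
pose F' n := if @unpickle I n is Some i then F i else set0.
apply: (@le_trans _ _ (m (\bigcup_n F' n))).
  apply: (ro_le rm) => x [i _ Fx]; exists (pickle i) => //.
  by rewrite /F' pickleK.
apply: (ro_bigcup rm) => n; rewrite mul0r /F'.
by case: unpickle => [i|]; rewrite ?F0 ?(ro_set0 rm).
Qed.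

Lemma radon_bigcup_gt0 (I : countType) (F : I -> set X) A :
  A `<=` \bigcup_i F i -> 0 < m A -> exists i, 0 < m (A `&` F i).
Proof.
move=> AF A0; apply: contrapT => H.
have : m (\bigcup_i (A `&` F i)) = 0.
  apply: radon_bigcup_count => i; apply/eqP.
  rewrite eq_le (ro_ge0 rm) andbT leNgt; apply/negP => Hi.
  by apply: H; exists i.
apply/eqP; rewrite gt_eqF//; apply: (lt_le_trans A0).
apply: (ro_le rm) => x Ax.
by have [i _ Fx] := AF x Ax; exists i.
Qed.

Lemma mu_measurableC A : mu_measurable (fun A => (m A)%:E) A ->
  mu_measurable (fun A => (m A)%:E) (~` A).
Proof.
move=> [B [B' [bB bB' BA AB' BB']]]; exists (~` B'), (~` B); split.
- exact: borelC.
- exact: borelC.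
- exact: subsetC.
- exact: subsetC.
- by rewrite setDE setCK setIC -setDE.
Qed.

Lemma mu_measurable_inner A C : mu_measurable (fun A => (m A)%:E) A ->
  borel C -> 0 < m (A `&` C) ->
  exists K, [/\ compact K, K `<=` A `&` C & 0 < m K].
Proof.
move=> [B [B' [bB bB' BA AB' [BB']]]] bC AC.
have BC : 0 < m (B `&` C).
  apply: (lt_le_trans AC); rewrite -[leRHS]addr0 -BB'.
  apply: le_trans (ro_setU rm _ _); apply: (ro_le rm) => x [Ax Cx].
  by have [Bx|nBx] := pselect (B x); [left|right; split => //; exact: AB'].
have [K [cK KBC K0]] := ro_inner rm (borelI bB bC) BC.
by exists K; split => // x /KBC [Bx Cx]; split => //; exact: BA.
Qed.

Lemma radon_disjoint (K L A : set X) : borel K -> K `<=` A -> L `<=` A ->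
  K `&` L = set0 -> m K + m L <= m A.
Proof.
move=> bK KA LA KL; rewrite (ro_cara rm bK A); apply: lerD; apply: (ro_le rm).
  by move=> x Kx; split => //; exact: KA.
move=> x Lx; split; first exact: LA.
by move=> Kx; apply: (eq_set0P (x := x) KL).
Qed.

Lemma radon_no_disjoint_seq (K : nat -> set X) a : (forall n, borel (K n)) ->
  (forall n, m (K n) = a) -> (forall n k, (n < k)%N -> K n `&` K k = set0) -> a <= 0.
Proof.
move=> bK Ka dK; rewrite leNgt; apply/negP => a0.
have H n : n%:R * a <= m (\bigcup_(i < n) K i).
  elim: n => [|n IH]; first by rewrite mul0r (ro_ge0 rm).
  rewrite -natr1 mulrDl mul1r addrC.
  apply: le_trans (radon_disjoint (K := K n) (L := \bigcup_(i < n) K i) _ _ _ _).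
  - by rewrite Ka lerD2l.
  - exact: bK.
  - by move=> x Kx; exists n => /=.
  - by move=> x [i /= ni Ki]; exists i => //=; exact: ltnW.
  - rewrite -subset0 => x [Kn [i /= ni Ki]].
    by apply: (eq_set0P (x := x) (dK i n ni)).
have := H (Num.bound a^-1); rewrite leNgt => /negP; apply.
apply: (@le_lt_trans _ _ 1).
  by rewrite -(ro_setT rm); exact: (ro_le rm).
rewrite -ltr_pdivrMr// mul1r.
by apply: archi_boundP; rewrite invr_ge0 ltW.
Qed.

(** The bound for the integral over [B] of a step function with values at most [c]; instead of
    integrating, [B] is split along one [K n] at a time. *)
Lemma radon_weights n (w : nat -> R) (K : nat -> set X) :
  (forall i, borel (K i)) -> forall B c, borel B ->
  (forall x, B x -> \sum_(i < n) (if `[< K i x >] then w i else 0) <= c) ->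
  \sum_(i < n) w i * m (K i `&` B) <= c * m B.
Proof.
move=> bK; elim: n => [|n IH] B c bB Bc.
  rewrite big_ord0; have [[x Bx]|B0] := pselect (B !=set0).
    by have := Bc x Bx; rewrite big_ord0 => c0; apply: mulr_ge0 => //; exact: (ro_ge0 rm).
  have -> : B = set0 by rewrite -subset0 => x Bx; apply: B0; exists x.
  by rewrite (ro_set0 rm) mulr0.
have split_sum : \sum_(i < n) w i * m (K i `&` B) =
    \sum_(i < n) w i * m (K i `&` (B `&` K n)) +
    \sum_(i < n) w i * m (K i `&` (B `\` K n)).
  rewrite -big_split /=; apply: eq_bigr => i _.
  by rewrite -mulrDr (ro_cara rm (bK n) (K i `&` B)) setIA setIDA.
rewrite big_ord_recr /= split_sum.
have I1 : \sum_(i < n) w i * m (K i `&` (B `&` K n)) <= (c - w n) * m (B `&` K n).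
  apply: IH => [|x [Bx Kx]]; first exact: borelI.
  have := Bc x Bx; rewrite big_ord_recr /=; case: asboolP => // _; lra.
have I2 : \sum_(i < n) w i * m (K i `&` (B `\` K n)) <= c * m (B `\` K n).
  apply: IH => [|x [Bx Kx]]; first exact: borelD.
  by have := Bc x Bx; rewrite big_ord_recr /=; case: asboolP => // _; rewrite addr0.
rewrite (ro_cara rm (bK n) B) mulrDr [K n `&` B]setIC.
by move: I1; rewrite mulrBl; lra.
Qed.

End RadonOuter.

(** * Disjoint refinement of a finite cover *)

Section Disjointify.
Context {R : realType} {X : topologicalType} {m : set X -> R}.
Hypothesis rm : radon_outer m.
Variables (N : nat -> set X) (H : set X).
Hypothesis bN : forall i, borel (N i).
Hypothesis bH : borel H.

Definition first_part n : set X := (H `&` N n) `\` \bigcup_(i < n) N i.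

Lemma first_part_sum_ge n : m (H `&` \bigcup_(i < n) N i) <= \sum_(i < n) m (first_part i).
Proof.
elim: n => [|n IH].
  by rewrite big_ord0 bigcup0// setI0 (ro_set0 rm).
rewrite big_ord_recr /=; apply: (le_trans _ (lerD IH (lexx _))).
apply: le_trans (ro_setU rm _ _); apply: (ro_le rm) => x [Hx [i /= + Nx]].
rewrite ltnS leq_eqVlt => /orP[/eqP E|ni]; last by left; split => //; exists i.
rewrite -{}E; have [D|nD] := pselect ((\bigcup_(j < i) N j) x); first by left.
by right; split.
Qed.

Lemma first_part_sum_le n (A : set X) (p : nat -> Prop) :
  (forall i, (i < n)%N -> p i -> first_part i `<=` A) ->
  \sum_(i < n) (if `[< p i >] then m (first_part i) else 0) <=
  m (A `&` \bigcup_(i < n) N i).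
Proof.
elim: n => [|n IH] pA; first by rewrite big_ord0 (ro_ge0 rm).
have bD k : borel (\bigcup_(i < k) N i).
  elim: k => [|k IHk]; first by rewrite bigcup0//; apply: borel_open; exact: open0.
  rewrite (_ : \bigcup_(i < k.+1) N i = (\bigcup_(i < k) N i) `|` N k).
    exact: borelU.
  apply/seteqP; split => x /=.
    move=> [i /=]; rewrite ltnS leq_eqVlt => /orP[/eqP ->|ni Ni]; [by right|left].
    by exists i.
  by move=> [[i /= ik Ni]|Nk]; [exists i => //=; exact: ltnW|exists k => /=].
rewrite big_ord_recr /= (ro_cara rm (bD n) (A `&` _)).
apply: lerD.
  apply: (le_trans (IH _)); first by move=> i ni; apply: pA; exact: ltnW.
  apply: (ro_le rm) => x [Ax Dx]; split => //; split => //.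
  by have [i /= ni Ni] := Dx; exists i => //=; exact: ltnW.
case: asboolP => [pn|_]; last exact: (ro_ge0 rm).
apply: (ro_le rm) => x Px; have [[_ Nx] nD] := Px; split => //; split.
  exact: (pA n).
by exists n => /=.
Qed.

End Disjointify.

(** * Continuity on compact subgroups *)

(** Dependent choice over finite histories, used to follow branches and to play against
    strategies. *)
Lemma prefix_choice (T : Type) (P : seq T -> T -> Prop) :
  (forall l, exists x, P l x) -> exists f : nat -> T, forall n, P (mkseq f n) (f n).
Proof.
move=> /choice [F HF].
pose L := fix L n := if n is n'.+1 then rcons (L n') (F (L n')) else [::].
exists (fun n => F (L n)) => n.
suff -> : mkseq (fun n => F (L n)) n = L n by exact: HF.
by elim: n => [//|n IH]; rewrite mkseqS IH.
Qed.

Section Hom.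
Context {X Y : topgroup} {h : X -> Y}.
Hypothesis hom : forall x y, h (x ** y) = h x ** h y.

Lemma hom1 : h \e = \e.
Proof. by apply: (@tmulI _ (h \e)); rewrite -hom !tgE. Qed.

Lemma homV x : h x^v = (h x)^v.
Proof. by apply: tinv_uniq; rewrite -hom tmulrV hom1. Qed.

End Hom.

Section CompactSubgroup.
Context {R : realType} {X : topgroup}.
Hypothesis hX : hausdorff_space X.
Variable H : set X.
Hypothesis cH : compact H.
Hypothesis H1 : H \e.
Hypothesis HM : forall x y, H x -> H y -> H (x ** y).
Hypothesis HV : forall x, H x -> H x^v.

Variable m : set X -> R.
Hypothesis rm : radon_outer m.
Hypothesis mH : m H = 1.
Hypothesis ml : forall g A, H g -> m [set y | A (g ** y)] = m A.
Hypothesis mr : forall g A, H g -> m [set y | A (y ** g)] = m A.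

Let bH : borel H. Proof. exact: borel_closed (compact_closed hX cH). Qed.

(** An open [U] around [K] of measure below twice that of [K] contains [g K] for all [g] near the
    identity, and it has no room for two disjoint copies of [K]. *)
Lemma haar_steinhaus K : compact K -> K `<=` H -> 0 < m K ->
  \forall g \near \e, H g -> exists k1 k2, [/\ K k1, K k2 & g = k1 ** k2^v].
Proof.
move=> cK KH K0.
have [ |U [oU KU mU]] := @ro_outer _ _ _ rm K (2 * m K); first by lra.
have : \forall g \near (\e : X), forall k, K k -> U (g ** k).
  apply: (@tube _ _ _ _ _ (fun g k => U (g ** k))) => // k Kk.
  have cv : (fun p : X * X => p.2 ** p.1) @ (nbhs k, nbhs (\e : X)) --> \e ** k.
    by tcvg.
  by apply: cv; rewrite tmul1; apply: open_nbhs_nbhs; split => //; exact: KU.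
apply: filterS => g gU Hg; apply: contrapT => nk.
have bK : borel K by exact: borel_closed (compact_closed hX cK).
have := @radon_disjoint _ _ _ rm K [set y | K (g^v ** y)] U bK KU.
rewrite ml; last exact: HV.
move=> Hd; have : m K + m K <= m U; last by lra.
apply: Hd.
  by move=> y /= Ky; have := gU _ Ky; rewrite !tgE.
rewrite -subset0 => y [Ky /= Kgy]; apply: nk.
by exists y, (g^v ** y); split => //; rewrite !tgE.
Qed.

(* Tonelli for an open set, through finitely many rectangles. *)
Lemma haar_fubini (Q : X -> X -> Prop) c d :
  (forall g x, Q g x -> \forall x' \near x & g' \near g, Q g' x') ->
  (forall x, H x -> m [set g | H g /\ Q g x] <= c) -> c < d ->
  exists2 g, H g & m [set x | H x /\ Q g x] <= d.
Proof.
move=> oQ Qc cd; apply: contrapT => nex.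
have c0 : 0 <= c := le_trans (ro_ge0 rm _) (Qc _ H1).
have oQg g : open [set x | Q g x].
  rewrite openE => x Qgx; have [[A B] /= [Ax Bg] AB] := oQ g x Qgx.
  apply: filterS Ax => x' Ax'; apply: (AB (x', g)); split => //=.
  exact: nbhs_singleton.
have HK g : exists K, H g -> [/\ compact K, K `<=` H `&` [set x | Q g x] & d < m K].
  have [Hg|nH] := pselect (H g); last by exists set0.
  have [ | |K HK] := @ro_inner _ _ _ rm (H `&` [set x | Q g x]) d.
  - by apply: borelI => //; exact: borel_open.
  - by rewrite ltNge; apply/negP => le; apply: nex; exists g.
  by exists K => _.
have {HK} [K HK] := choice HK.
(* The rectangle with sides [N g] and [K g] lies in [Q], and the tube lemma makes [N g] a
   neighbourhood of [g]. *)
pose N g := [set g' | forall x, K g x -> Q g' x]°.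
have Ng g : H g -> nbhs g (N g).
  move=> /HK [cK KQ _]; apply/nbhs_interior.
  by apply: (@tube _ _ _ _ _ Q) => // k /KQ [_]; exact: oQ.
have [s [sH scov]] := compact_finite_cover cH Ng.
pose N' i := N (nth \e s i); pose K' i := K (nth \e s i); pose n := size s.
have bN i : borel (N' i) by apply: borel_open; exact: open_interior.
have sH' i : (i < n)%N -> H (nth \e s i) by move=> ni; apply: sH; exact: mem_nth.
pose K'' i := if (i < n)%N then K' i else set0.
have bK i : borel (K'' i).
  rewrite /K''; case: ifPn => [ni|_]; last by apply: borel_open; exact: open0.
  by have [cK _ _] := HK _ (sH' i ni); apply: borel_closed; exact: compact_closed.
pose P i := first_part N' H i.
(* The rectangles with sides [P i] and [K'' i] are disjoint. Their total measure is at most [c] by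
   the sections at fixed [x], but at least [d] because each [K'' i] has measure above [d] and the
   [P i] exhaust [H]. *)
have W := @radon_weights _ _ _ rm n (fun i => m (P i)) K'' bK H c bH.
have : \sum_(i < n) m (P i) * m (K'' i `&` H) <= c * m H.
  apply: W => x Hx; apply: le_trans (Qc x Hx).
  apply: le_trans (first_part_sum_le rm (H := H) bN (n := n)
    (A := [set g | H g /\ Q g x]) (p := fun i => K'' i x) _) _.
    move=> i ni K''x g [[Hg Ng'] _]; split => //.
    by move: K''x; rewrite /K'' ni; exact: (interior_subset Ng').
  by apply: (ro_le rm); exact: subIsetl.
apply/negP; rewrite -ltNge mH mulr1; apply: (lt_le_trans cd).
apply: (@le_trans _ _ (d * \sum_(i < n) m (P i))); last first.
  rewrite mulr_sumr; apply: ler_sum => i _; rewrite mulrC; apply: ler_wpM2l.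
    exact: (ro_ge0 rm).
  rewrite /K'' ltn_ord; have [_ KQ /ltW dK] := HK _ (sH' i (ltn_ord i)).
  apply: le_trans dK _; apply: (ro_le rm) => x Kx; split => //.
  by have [] := KQ x Kx.
have d0 : 0 <= d by apply: ltW; exact: le_lt_trans cd.
rewrite -{1}[d]mulr1; apply: ler_wpM2l => //.
apply: le_trans (first_part_sum_ge rm N' H n).
rewrite -mH; apply: (ro_le rm) => x Hx; split => //.
have [y ys Ny] := scov x Hx.
exists (index y s); first by rewrite /= index_mem.
by rewrite /N' nth_index.
Qed.

(** * Sequences whose differences avoid a null set *)

Section Scattered.
Variable A : set X.
Hypothesis mA : m A = 0.

(** For fixed [x] the bad [g] lie in finitely many two-sided translates of an open set around [A] of
    measure below [c], so they have measure at most [e / 2]. Tonelli turns this into one [g] that is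
    bad for few [x]. *)
Lemma haar_next (l : seq X) (e : R) : (forall t, t \in l -> H t) -> 0 < e ->
  exists2 g, H g &
    m [set x | H x /\ exists2 t, t \in l & A ((t ** x)^v ** (g ** x))] <= e.
Proof.
move=> lH e0.
pose c := e / 2 / (size l).+1%:R.
have c0 : 0 < c by rewrite !divr_gt0// ltr0n.
have [W [oW AW mW]] : exists W, [/\ open W, A `<=` W & m W < c].
  by apply: (ro_outer rm); rewrite mA.
have [ | | |g Hg mg] := @haar_fubini
    (fun g x => exists2 t, t \in l & W ((t ** x)^v ** (g ** x))) (e / 2) e.
- move=> g x [t tl Wt].
  have cv : (fun p : X * X => (t ** p.1)^v ** (p.2 ** p.1)) @ (nbhs x, nbhs g) -->
      (t ** x)^v ** (g ** x) by tcvg.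
  have [[B C] /= [Bx Cg] BC] := cv W (open_nbhs_nbhs (conj oW Wt)).
  by exists (B, C) => //= -[x' g'] /= BCx; exists t => //; exact: (BC (x', g')).
- move=> x Hx.
  have key (k : seq X) : {subset k <= l} ->
      m [set g | H g /\ exists2 t, t \in k & W ((t ** x)^v ** (g ** x))] <=
      (size k)%:R * m W.
    elim: k => [|t k IH] kl.
      rewrite (_ : [set _ | _] = set0) ?(ro_set0 rm) ?mul0r//.
      by rewrite -subset0 => g [_ []].
    rewrite /= -natr1 mulrDl mul1r addrC.
    apply: (@le_trans _ _ (m W + m [set g | H g /\
        exists2 t, t \in k & W ((t ** x)^v ** (g ** x))])); last first.
      by rewrite lerD2l; apply: IH => s sk; apply: kl; rewrite inE sk orbT.
    have Htx : H (t ** x)^v.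
      by apply: HV; apply: HM => //; apply: lH; apply: kl; rewrite inE eqxx.
    rewrite -[m W](ml _ Htx) -[m [set y | W _]](mr _ Hx).
    apply: le_trans (ro_setU rm _ _); apply: (ro_le rm) => g [Hg [s]].
    rewrite inE => /orP[/eqP -> Ws|sk Ws]; [by left|right].
    by split => //; exists s.
  apply: le_trans (key l _) _ => //.
  apply: (@le_trans _ _ ((size l).+1%:R * c)).
    apply: ler_pM => //; [exact: (ro_ge0 rm)|by rewrite ler_nat|exact: ltW].
  by rewrite /c mulrC divfK// pnatr_eq0.
- by rewrite ltr_pdivrMr// ltr_pMr// ltr1n.
exists g => //; apply: le_trans mg; apply: (ro_le rm) => x [Hx [t tl At]].
by split => //; exists t => //; exact: AW.
Qed.

(** The choice of [f n] loses at most [2^-1 / 2^(n+1)] of the measure, hence all choices together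
    lose at most one half. *)
Lemma haar_scattered_seq : exists f : nat -> X, (forall n, H (f n)) /\
  2^-1 <= m [set x | H x /\
    forall n i, (i < n)%N -> ~ A ((f i ** x)^v ** (f n ** x))].
Proof.
pose P (l : seq X) g := (forall t, t \in l -> H t) -> H g /\
  m [set x | H x /\ exists2 t, t \in l & A ((t ** x)^v ** (g ** x))] <=
    2^-1 / (2 ^ (size l).+1)%:R.
have [l|f Pf] := @prefix_choice X P.
  have [lH|nlH] := pselect (forall t, t \in l -> H t); last by exists \e.
  have [ | |g Hg mg] := @haar_next l (2^-1 / (2 ^ (size l).+1)%:R) => //.
  by exists g.
have fH n : H (f n).
  elim/ltn_ind: n => n IH.
  have [|//] := Pf n; move=> t /mapP [i + ->].
  by rewrite mem_iota => /andP[_ +]; rewrite add0n; exact: IH.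
exists f; split => //.
pose bad n := [set x | H x /\ exists2 t, t \in mkseq f n & A ((t ** x)^v ** (f n ** x))].
have mbad : m (\bigcup_n bad n) <= 2^-1.
  apply: (ro_bigcup rm) => n.
  have [|_] := Pf n; first by move=> t /mapP [i _ ->].
  by rewrite size_mkseq.
set G := [set x | _].
have : m H <= m (\bigcup_n bad n) + m G.
  apply: le_trans (ro_setU rm _ _); apply: (ro_le rm) => x Hx.
  have [Bx|nB] := pselect ((\bigcup_n bad n) x); first by left.
  right; split => // n i ni Ai; apply: nB; exists n => //; split => //.
  by exists (f i) => //; apply: map_f; rewrite mem_iota add0n ni.
rewrite mH; lra.
Qed.

End Scattered.

End CompactSubgroup.

Section CompactSubgroupContinuity.
Context {R : realType} {X Y : topgroup} {h : X -> Y}.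
Hypothesis hX : hausdorff_space X.
Hypothesis hom : forall x y, h (x ** y) = h x ** h y.
Hypothesis um : universally_measurable_fun R h.
Variable H : set X.
Hypothesis cH : compact H.
Hypothesis H1 : H \e.
Hypothesis HM : forall x y, H x -> H y -> H (x ** y).
Hypothesis HV : forall x, H x -> H x^v.

Section Haar.
Variable m : set X -> R.
Hypothesis rm : radon_outer m.
Hypothesis mH : m H = 1.
Hypothesis ml : forall g A, H g -> m [set y | A (g ** y)] = m A.

Let bH : borel H. Proof. exact: borel_closed (compact_closed hX cH). Qed.

Variable V : nat -> set Y.
Hypothesis cV : nbhs_chain V.

Variable f : nat -> X.
Hypothesis fH : forall n, H (f n).

(** The value of a word in the [f n] and their inverses. Words form a countable type, so some single
    word gives a set of positive measure below. *)
Let ev (w : seq (nat * bool)) : X :=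
  foldr (fun p a => (if p.2 then f p.1 else (f p.1)^v) ** a) \e w.

(** The shift is 1 + 3: three doublings make room for eight factors, and [ball6] uses six. *)
Let V4 i : set Y := V (i + 4)%N.
Let cV4 : nbhs_chain V4. Proof. exact: chain_add. Qed.

Let ball6 a b c d v w : V4 0%N a -> V4 0%N b -> V4 0%N c -> V4 0%N d ->
  V4 0%N v -> V4 0%N w -> V 1 (a ** b ** c ** d ** v ** w).
Proof.
move=> Va Vb Vc Vd Vv Vw; rewrite !tmulA -tmulA.
rewrite (_ : c ** _ = (c ** d) ** (v ** w)); last by rewrite !tgE.
by apply: (chainM cV); [apply: (chainS cV)|]; apply: (chainM cV) => //;
  apply: (chainM cV).
Qed.

(* Vitali's argument: [Q] has positive measure, but the sets [f k Q] are
   pairwise disjoint because [stone_piece Gam] is invariant under [Gam]. *)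
Lemma scattered_null : ~ 0 < m [set x | H x /\
  forall n i, (i < n)%N -> ~ V 1 (h ((f i ** x)^v ** (f n ** x)))].
Proof.
set P := [set x | _] => P0.
pose Gam : set Y := [set h (ev w) | w in setT].
have Gam1 : Gam \e by exists [::] => //=; exact: hom1.
have GamM k g : Gam g -> Gam (h (f k) ** g).
  by move=> [w _ <-]; exists ((k, true) :: w) => //=; rewrite hom.
have GamV k g : Gam g -> Gam ((h (f k))^v ** g).
  by move=> [w _ <-]; exists ((k, false) :: w) => //=; rewrite hom (homV hom).
pose E n w s y := stone_piece V4 Gam n s y /\ stone_ball V4 n ((h (ev w) ** s)^v ** y).
have [[n w] nwP] : exists i : nat * seq (nat * bool),
    0 < m (P `&` [set x | exists s, E i.1 i.2 s (h x)]).
  apply: (radon_bigcup_gt0 rm) P0 => x Px.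
  have [n [s sx]] := stone_piece_cover cV4 (h x) Gam1.
  have [[g [w _ <-] Bx] _] := sx.
  by exists (n, w) => //; exists s.
pose S := [set s | exists2 p, P p & E n w s (h p)].
(* An open thickening of the cells that meet the image of [P]; a witness in [P] is kept for each
   cell, and the thickening is fine enough to preserve the separation of the pieces. *)
pose Q := [set y | exists s z, [/\ S s, E n w s z & V4 n.+3 (z^v ** y)]].
have oQ : open Q.
  rewrite (_ : Q = \bigcup_(sz in [set sz | S sz.1 /\ E n w sz.1 sz.2])
      [set y | V4 n.+3 (sz.2^v ** y)]).
    apply: bigcup_open => -[s z] _ /=.
    by apply: open_comp (chain_open cV4 _) => x _; exact: tmul_l_cts.
  apply/seteqP; split=> y.
    by move=> [s [z [Ss Ez Vz]]]; exists (s, z).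
  by move=> [[s z] /= [Ss Ez] Vz]; exists s, z.
have Q0 : 0 < m (h @^-1` Q `&` H).
  apply: (lt_le_trans nwP); apply: (ro_le rm) => x [Px [s Esx]].
  split; last by case: Px.
  exists s, (h x); split => //; first by exists x.
  by rewrite !tgE; exact: (chain1 cV4).
have [K [cK KQ K0]] := mu_measurable_inner rm (um oQ (ro_prob rm)) bH Q0.
pose K' k := [set y | K ((f k)^v ** y)].
have dK k l : (k < l)%N -> K' k `&` K' l = set0.
  move=> kl; rewrite -subset0 => y [Ky Ky'].
  have [[s [z [[p [_ Psep] [_ Bp]] [Ez Bz] Vz]]] _] := KQ _ Ky.
  have [[s' [z' [_ [Ez' Bz'] Vz']]] _] := KQ _ Ky'.
  have shift i t u : stone_piece V4 Gam n t u -> stone_piece V4 Gam n t (h (f i) ** u).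
    move=> [[g Gg Bg] Hu]; split.
      by exists (h (f i) ** g); [exact: GamM|rewrite !tgE in Bg *].
    move=> s0 g0 m0 lt Gg0; have := Hu s0 _ m0 lt (GamV i _ Gg0).
    by rewrite !tgE.
  have hfy i : h ((f i)^v ** y) = (h (f i))^v ** h y by rewrite hom (homV hom).
  rewrite hfy in Vz; rewrite hfy in Vz'.
  (* After translation by [h (f k)] and [h (f l)], both [z] and [z'] are close to [h y]; the pieces
     are invariant under these translations and separated, so the centres agree. *)
  have ss' : s = s'.
    apply: (stone_piece_sep cV4 (shift k _ _ Ez) (shift l _ _ Ez')).
    have -> : (h (f k) ** z)^v ** (h (f l) ** z') =
      (z^v ** ((h (f k))^v ** h y)) ** (z'^v ** ((h (f l))^v ** h y))^v.
      by rewrite !tgE.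
    by apply: (chainM cV4) => //; exact: (chainV cV4).
  move: Bz'; rewrite -ss' => Bz'.
  have sub := @stone_ball_sub _ _ cV4 n.
  apply: (Psep l k kl); rewrite !hom !(homV hom) !hom.
  set g := h (ev w) ** s in Bp Bz Bz'.
  (* The path from [f k p] to [f l p] runs through the common centre, [z], [y], [z'] and the centre
     again. Its six short steps contradict the scatteredness of [f] at [p]. *)
  have -> : (h (f k) ** h p)^v ** (h (f l) ** h p) =
    (g^v ** h p)^v ** (g^v ** z) ** (z^v ** ((h (f k))^v ** h y)) **
    (z'^v ** ((h (f l))^v ** h y))^v ** (g^v ** z')^v ** (g^v ** h p).
    by rewrite !tgE.
  apply: ball6; rewrite ?(chainV cV4)//; try exact: sub.
  - by apply: (chainV cV4); exact: sub.
  - by apply: (chain_le cV4) Vz.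
  - by apply: (chainV cV4); apply: (chain_le cV4) Vz'.
  - by apply: (chainV cV4); exact: sub.
have := radon_no_disjoint_seq rm (K := K') (a := m K) _ _ dK.
move: K0; rewrite ltNge => /negP nle H'; apply/nle/H'.
- move=> k; apply: borel_closed; apply: compact_closed => //.
  rewrite (_ : K' k = tg_mul (f k) @` K).
    by apply: continuous_compact => //; apply: continuous_subspaceT; exact: tmul_l_cts.
  apply/seteqP; split => y; first by exists ((f k)^v ** y) => //; rewrite !tgE.
  by move=> [x Kx <-]; rewrite /K' /= !tgE.
- by move=> k; apply: ml; exact: HV.
Qed.

End Haar.

(** If the preimage of [V 1] has positive Haar measure, Steinhaus's argument applies; if it is null,
    a scattered sequence exists, contrary to [scattered_null]. *)
Theorem compact_subgroup_continuous (U : set Y) : nbhs \e U ->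
  \forall g \near \e, H g -> U (h g).
Proof.
move=> U1.
have [m [rm mH ml mr]] := @haar_measure R X hX H cH H1 HM HV.
have [V cV VU] := nbhs_chain_ex U1.
have bH : borel H by exact: borel_closed (compact_closed hX cH).
have [A0|A0] := ltP 0 (m (h @^-1` (V 1))).
  have A0' : 0 < m (h @^-1` (V 1) `&` H).
    have := ro_cara rm bH setT; rewrite setTI setTD mH (ro_setT rm).
    have := ro_le rm (@subIsetr _ (h @^-1` (V 1)) (~` H)).
    have := ro_cara rm bH (h @^-1` (V 1)); rewrite setDE; lra.
  have [K [cK KV K0]] :=
    mu_measurable_inner rm (um (chain_open cV 1) (ro_prob rm)) bH A0'.
  have KH : K `<=` H by move=> x /KV[].
  apply: filterS (haar_steinhaus hX HV rm ml cK KH K0) => g gK Hg.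
  have [k1 [k2 [/KV [Vk1 _] /KV [Vk2 _] ->]]] := gK Hg.
  apply: VU; rewrite hom (homV hom); apply: (chainM cV) => //.
  exact: (chainV cV).
have mA : m (h @^-1` (V 1)) = 0 by apply/eqP; rewrite eq_le A0 (ro_ge0 rm).
have [f [fH fP]] := haar_scattered_seq hX cH H1 HM HV rm mH ml mr mA.
case: (scattered_null rm ml cV fH).
by apply: lt_le_trans fP; rewrite invr_gt0.
Qed.

End CompactSubgroupContinuity.

(** * Densities of binary trees *)

Section Density.
Context {R : realType}.
Implicit Types (T P Q : seq bool -> Prop) (s w : seq bool).

(** The proportion of the [2^n] extensions of [s] by [n] bits that satisfy [T]. *)
Fixpoint dens T (n : nat) s : R :=
  if n is n'.+1 then (dens T n' (rcons s false) + dens T n' (rcons s true)) / 2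
  else if `[< T s >] then 1 else 0.

Definition tree T : Prop := forall s b, T (rcons s b) -> T s.

Lemma dens01 T n s : 0 <= dens T n s <= 1.
Proof.
elim: n s => [|n IH] s /=; first by case: ifP; rewrite ?lexx ler01.
by have := IH (rcons s false); have := IH (rcons s true); lra.
Qed.

Lemma dens_le P Q n s : (forall s, P s -> Q s) -> dens P n s <= dens Q n s.
Proof.
move=> PQ; elim: n s => [|n IH] s /=.
  by case: asboolP => [/PQ Qs|_]; case: asboolP.
by have := IH (rcons s false); have := IH (rcons s true); lra.
Qed.

Lemma densT n s : dens (fun=> True) n s = 1.
Proof. by elim: n s => [|n IH] s /=; [case: asboolP|rewrite !IH; lra]. Qed.

Lemma densU P Q n s :
  dens (fun s => P s \/ Q s) n s <= dens P n s + dens Q n s.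
Proof.
elim: n s => [|n IH] s /=.
  by do 3 case: asboolP => ?; first [lra|tauto].
by have := IH (rcons s false); have := IH (rcons s true); lra.
Qed.

Lemma densU_disj P Q n s : (forall s, P s -> Q s -> False) ->
  dens P n s + dens Q n s <= dens (fun s => P s \/ Q s) n s.
Proof.
move=> PQ; elim: n s => [|n IH] s /=.
  by have := PQ s; do 3 case: asboolP => ?; first [lra|tauto].
by have := IH (rcons s false); have := IH (rcons s true); lra.
Qed.

Lemma dens_eq0 T n s : (forall w, size w = n -> ~ T (s ++ w)) -> dens T n s = 0.
Proof.
elim: n s => [|n IH] s H /=.
  by case: asboolP => // Ts; case: (H [::] erefl); rewrite cats0.
by rewrite !IH ?addr0 ?mul0r// => w sw; rewrite cat_rcons; apply: H; rewrite /= sw.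
Qed.

Lemma densS T n s : tree T -> dens T n.+1 s <= dens T n s.
Proof.
move=> tT; elim: n s => [|n IH] s /=; last first.
  by have := IH (rcons s false); have := IH (rcons s true) => /=; lra.
case: (asboolP (T s)) => Ts.
  by do 2 case: asboolP => _; lra.
by do 2 (case: asboolP => [/tT//|_]); lra.
Qed.

Lemma dens_anti T m n s : tree T -> (m <= n)%N -> dens T n s <= dens T m s.
Proof.
move=> tT /subnK <-; elim: (n - m)%N => [|k IH] //.
by apply: le_trans IH; exact: densS.
Qed.

(** Each common continuation [w] counts towards at most one of the two densities. *)
Lemma dens_pair T1 T2 n s1 s2 :
  (forall w, size w = n -> ~ (T1 (s1 ++ w) /\ T2 (s2 ++ w))) ->
  dens T1 n s1 + dens T2 n s2 <= 1.
Proof.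
elim: n s1 s2 => [|n IH] s1 s2 H /=.
  have := H [::] erefl; rewrite !cats0.
  by do 2 (case: asboolP => ?); first [lra|tauto].
have I b : dens T1 n (rcons s1 b) + dens T2 n (rcons s2 b) <= 1.
  by apply: IH => w sw; rewrite !cat_rcons; apply: H; rewrite /= sw.
by have := I false; have := I true; lra.
Qed.

Lemma dens_trunc P T j k s :
  (forall w, size w = (size s + (k + j))%N -> P w -> T (take (size s + k) w)) ->
  dens P (k + j) s <= dens T k s.
Proof.
elim: k s => [|k IH] s H /=.
  rewrite add0n; case: asboolP => Ts; first by case/andP: (dens01 P j s).
  rewrite dens_eq0// => w sw Pw.
  have sz : size (s ++ w) = (size s + (0 + j))%N by rewrite size_cat sw.
  by have := H _ sz Pw; rewrite addn0 take_size_cat.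
have I b : dens P (k + j) (rcons s b) <= dens T k (rcons s b).
  by apply: IH => w; rewrite size_rcons !addSnnS; exact: H.
by have := I false; have := I true; lra.
Qed.

(** A node with extensions of every length has a successor of the same kind, and following such
    successors gives the branch. *)
Lemma koenig T : tree T -> (forall n, exists2 w, size w = n & T w) ->
  exists eps : nat -> bool, forall n, T (mkseq eps n).
Proof.
move=> tT HT.
pose inf s := forall n, exists2 w, size w = n & T (s ++ w).
have tcat s w : T (s ++ w) -> T s.
  by elim/last_ind: w => [|w b IH]; rewrite ?cats0// -rcons_cat => /tT.
have [s|eps Heps] := @prefix_choice bool (fun s b => inf s -> inf (rcons s b)).
  apply: contrapT => H.
  have nb b : exists n, inf s /\ forall w, size w = n -> ~ T (rcons s b ++ w).
    have /not_implyP [infs /existsNP [n Hn]] : ~ (inf s -> inf (rcons s b)).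
      by move=> Hb; apply: H; exists b.
    by exists n; split => // w sw Tw; apply: Hn; exists w.
  have [n0 [infs H0]] := nb false; have [n1 [_ H1]] := nb true.
  have [[//|b w] /= [sw] Tw] := infs (maxn n0 n1).+1.
  have tk k : T (rcons s b ++ take k w).
    by apply: (tcat _ (drop k w)); rewrite -catA cat_take_drop cat_rcons.
  case: b {Tw} tk => tk.
    by apply: H1 (tk n1); rewrite size_takel// sw leq_maxr.
  by apply: H0 (tk n0); rewrite size_takel// sw leq_maxl.
have infe n : inf (mkseq eps n).
  by elim: n => [|n IH]; [move=> n; exact: HT|rewrite mkseqS; exact: Heps].
exists eps => n; have [w] := infe n 0%N.
by move=> /size0nil ->; rewrite cats0.
Qed.

(* If no node had a common extension of its two successors, the density above
   every node would be at most 1/2, and hence it would be 0. *)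
Lemma tree_steinhaus T (c : R) : tree T -> 0 < c ->
  (forall n, c <= dens T n [::]) ->
  exists s, exists eps : nat -> bool,
    forall n, T (rcons s false ++ mkseq eps n) /\ T (rcons s true ++ mkseq eps n).
Proof.
move=> tT c0 cT; apply: contrapT => H.
have half s : exists m, dens T m s <= 2^-1.
  have [m Hm] : exists m, forall w, size w = m ->
      ~ (T (rcons s false ++ w) /\ T (rcons s true ++ w)).
    apply: contrapT => Hs; apply: H; exists s.
    apply: (@koenig (fun w => T (rcons s false ++ w) /\ T (rcons s true ++ w))).
      by move=> w b; rewrite -!rcons_cat => -[/tT ? /tT].
    move=> n; apply: contrapT => Hn; apply: Hs; exists n => w sw Tw.
    by apply: Hn; exists w.
  by exists m.+1 => /=; have := dens_pair Hm; lra.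
(* Using [half] above each node of level [N] halves the density; a maximum over these finitely many
   nodes gives a common level. *)
have step N s : exists n, dens T n s <= dens T N s / 2.
  elim: N s => [|N IH] s /=.
    case: asboolP => Ts; first by have [m Hm] := half s; exists m; lra.
    exists 0%N => /=; case: asboolP => //; lra.
  have [n0 H0] := IH (rcons s false); have [n1 H1] := IH (rcons s true).
  exists (maxn n0 n1).+1 => /=.
  have := dens_anti (rcons s false) tT (leq_maxl n0 n1).
  have := dens_anti (rcons s true) tT (leq_maxr n0 n1); lra.
have small k : exists n, dens T n [::] <= 2^-1 ^+ k.
  elim: k => [|k [n Hn]].
    by exists 0%N; rewrite expr0; case/andP: (dens01 T 0 [::]).
  have [n' Hn'] := step n [::]; exists n'; rewrite exprS; lra.
have [k Hk] : exists k : nat, (2^-1 : R) ^+ k < c.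
  exists (Num.bound c^-1).
  rewrite exprVn invf_plt ?posrE ?exprn_gt0//.
  apply: (lt_trans (archi_boundP _)); first by rewrite invr_ge0 ltW.
  by rewrite -natrX ltr_nat ltn_expl.
have [n Hn] := small k.
by have := le_lt_trans (le_trans (cT n) Hn) Hk; rewrite ltxx.
Qed.

End Density.

(** * Measures carried by trees of compact sets *)

Section Embedding.
Context {X K : topologicalType} {e : X -> K}.
Hypothesis cK : compact [set: K].
Hypothesis hK : hausdorff_space K.
Hypothesis ee : embedding e.

Let einj : injective e. Proof. by case: ee. Qed.
Let ects : continuous e. Proof. by case: ee. Qed.

Lemma embedding_nbhs (x : X) (A : set X) : nbhs x A ->
  exists2 V, open V & V (e x) /\ forall y, V (e y) -> A y.
Proof.
rewrite nbhsE => -[U [oU Ux] UA]; case: ee => _ _ /(_ U oU) [V oV VE].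
have VU y : V (e y) <-> U y.
  split=> [Vy|Uy].
    have : (V `&` range e) (e y) by split => //; exists y.
    by rewrite -VE => -[z Uz /einj <-].
  have : (e @` U) (e y) by exists y.
  by rewrite VE => -[].
by exists V => //; split=> [|y]; [exact/VU|move/VU/UA].
Qed.

Lemma embedding_hausdorff : hausdorff_space X.
Proof.
move=> x y clxy; apply: einj; apply: hK => A B Ax By.
have [z [Az Bz]] := clxy _ _ (ects Ax) (ects By).
by exists (e z).
Qed.

Lemma embedding_compact (D : set K) : closed D -> D `<=` range e ->
  compact (e @^-1` D).
Proof.
move=> cD Dr F PF FD.
have cptD : compact D by apply: (subclosed_compact cD cK).
have [z [Dz clz]] := cptD (e @ F) _ FD.
have [x _ xz] := Dr z Dz; exists x; split; first by rewrite /= xz.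
move=> A B FA Bx; have [V oV [Vx VB]] := embedding_nbhs Bx.
have FeA : (e @ F) (e @` A) by apply: (@filterS _ F _ A) => // a Aa; exists a.
have Vz : nbhs z V by rewrite -xz; exact: open_nbhs_nbhs.
have [t [[a Aa <-] Ve]] := clz _ _ FeA Vz.
by exists a; split => //; exact: VB.
Qed.

Lemma compact_nested (F : nat -> set K) : (forall n, closed (F n)) ->
  (forall n, F n !=set0) -> (forall n, F n.+1 `<=` F n) ->
  exists z, forall n, F n z.
Proof.
move=> cF F0 Fd.
have Fle m n : (m <= n)%N -> F n `<=` F m.
  move=> /subnK <-; elim: (n - m)%N => [|k IH] //=; rewrite addSn.
  exact: subset_trans (Fd _) IH.
pose G := [set A : set K | exists n, F n `<=` A].
have GF : ProperFilter G.
  split; first by move=> [n Fn]; have [z Fz] := F0 n; exact: Fn Fz.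
  split; first by exists 0%N.
  - move=> A B [n FA] [k FB]; exists (maxn n k) => z Fz; split.
      by apply: FA; apply: Fle Fz; exact: leq_maxl.
    by apply: FB; apply: Fle Fz; exact: leq_maxr.
  - by move=> A B AB [n FA]; exists n; exact: subset_trans AB.
have [|z [_ clz]] := cK (F := G) _; first by exists 0%N.
exists z => n; apply: cF => B Bz.
have [|t [Ft Bt]] := clz (F n) B _ Bz; first by exists n.
by exists t.
Qed.

End Embedding.

Section TreeMeasure.
Context {R : realType} {X K : topologicalType} {e : X -> K}.
Hypothesis cK : compact [set: K].
Hypothesis hK : hausdorff_space K.
Hypothesis ee : embedding e.
Variable F : seq bool -> set K.
Hypothesis cF : forall s, closed (F s).
Hypothesis F0 : forall s, F s !=set0.
Hypothesis Fd : forall s b, F (rcons s b) `<=` F s.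
Hypothesis Fr : forall eps z, (forall n, F (mkseq eps n) z) -> range e z.

(** Without metrizability a branch need not shrink to one point, so it is represented by all points
    along it. *)
Definition branch_set (eps : nat -> bool) : set X :=
  [set x | forall n, F (mkseq eps n) (e x)].

Lemma branch_set_ex : exists phi : (nat -> bool) -> X,
  forall eps, branch_set eps (phi eps).
Proof.
suff H eps : exists x, branch_set eps x by have [phi Hphi] := choice H; exists phi.
have [ | | |z Fz] := @compact_nested _ cK (fun n => F (mkseq eps n)).
- by move=> n; exact: cF.
- by move=> n; exact: F0.
- by move=> n; rewrite mkseqS; exact: Fd.
have [x _ xz] := Fr Fz; exists x => n.
by rewrite xz.
Qed.

Definition level_set (P : seq bool -> Prop) n : set K :=
  [set z | exists2 t : n.-tuple bool, t \in enum {: n.-tuple bool} &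
    (if `[< P t >] then F t else set0) z].

Lemma level_setP P n z : level_set P n z <-> exists s, [/\ size s = n, P s & F s z].
Proof.
split=> [[t _]|[s [sn Ps Fs]]].
  by case: asboolP => // Pt Ft; exists t; rewrite size_tuple.
have sn' : size s == n by exact/eqP.
exists (Tuple sn'); first by rewrite mem_enum.
by case: asboolP.
Qed.

Lemma level_set_closed P n : closed (level_set P n).
Proof.
apply: closed_seq => t _; case: asboolP => _ //; exact: closed0.
Qed.

(** By König's lemma, a point that lies in some cell of each level lies along a single branch. *)
Lemma branch_setU : \bigcup_eps branch_set eps =
  e @^-1` (\bigcap_n level_set (fun=> True) n).
Proof.
apply/seteqP; split => x.
  move=> [eps _ Fx] n _; apply/level_setP; exists (mkseq eps n).
  by rewrite size_mkseq; split => //; exact: Fx.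
move=> Lx; have [s b|n|eps Heps] := @koenig (fun s => F s (e x)).
- exact: Fd.
- by have /level_setP [s [sn _ Fs]] := Lx n I; exists s.
- by exists eps.
Qed.

Lemma branch_setU_compact : compact (\bigcup_eps branch_set eps).
Proof.
rewrite branch_setU; apply: (embedding_compact cK ee).
  by apply: closed_bigI => n _; exact: level_set_closed.
move=> z Lz; have [s b|n|eps Heps] := @koenig (fun s => F s z).
- exact: Fd.
- by have /level_setP [s [sn _ Fs]] := Lz n I; exists s.
- exact: Fr Heps.
Qed.

Definition hits (C : set X) (s : seq bool) : Prop := exists2 x, C x & F s (e x).

Lemma hits_tree C : tree (hits C).
Proof. by move=> s b [x Cx /Fd Fx]; exists x. Qed.

Let Gex := ultraFilterLemma (@eventually_filter).
Let G := projT1 (cid Gex).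
Let UG : UltraFilter G. Proof. exact: (projT2 (cid Gex)).1. Qed.
Let subG : \oo `<=` G.
Proof. exact: (projT2 (cid Gex)).2. Qed.
Existing Instance UG.

(** Pick a point [phi eps] on each branch. The content of [C] is the limit along an ultrafilter of
    the proportion of words of length [n] whose continuation by [false] leads to a point of [C]. *)
Theorem tree_measure : exists m : set X -> R, [/\ radon_outer m,
  forall C n, compact C -> m C <= dens (hits C) n [::] &
  m (~` \bigcup_eps branch_set eps) = 0].
Proof.
have hX := embedding_hausdorff hK ee.
have [phi Hphi] := branch_set_ex.
pose pad (s : seq bool) i := nth false s i.
pose d (C : set X) n : R := dens (fun s => C (phi (pad s))) n [::].
have d01 C n : 0 <= d C n <= 1 by exact: dens01.
pose k (C : set X) := ulim G (d C).
have k01 C : compact C -> 0 <= k C <= 1 by move=> _; exact: ulim_ge0le1.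
have b2 C L n : 0 <= d C n + d L n <= 2.
  by have := d01 C n; have := d01 L n; lra.
have k_ge0 C : compact C -> 0 <= k C by move=> /k01 /andP[].
have k_le1 C : compact C -> k C <= 1 by move=> /k01 /andP[].
have kU C L : compact C -> compact L -> k (C `|` L) <= k C + k L.
  move=> _ _; rewrite /k -(ulimD (d01 C) (d01 L)).
  apply: (ulim_le (d01 _) (b2 C L)); apply: filterE => n; exact: densU.
have kUd C L : compact C -> compact L -> C `&` L = set0 -> k C + k L <= k (C `|` L).
  move=> _ _ CL; rewrite /k -(ulimD (d01 C) (d01 L)).
  apply: (ulim_le (b2 C L) (d01 _)); apply: filterE => n; apply: densU_disj.
  by move=> s Cs Ls; apply: (eq_set0P (x := phi (pad s)) CL).
pose C0 := \bigcup_eps branch_set eps.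
have cC0 : compact C0 by exact: branch_setU_compact.
have kC0 : k C0 = 1.
  rewrite /k (_ : d C0 = fun=> 1) ?ulim_cst//; apply/funext => n.
  apply/eqP; rewrite eq_le; have /andP[_ ->] := d01 C0 n.
  rewrite /= -(@densT R n [::]); apply: dens_le => s _.
  by exists (pad s).
have rm := content_outer_radon hX k_ge0 kU kUd k_le1 cC0 kC0.
exists (content_outer k); split => //.
- move=> C n cC.
  (* The points outside every level-[n] cell that misses [C]. If [phi (pad w)] is among them, the
     first [n] bits of [w] form a cell hit by [C], which bounds the inner content of [U]. *)
  pose U := e @^-1` (~` level_set (fun s => ~ hits C s) n).
  have oU : open U.
    apply: open_comp; last exact/closed_openC/level_set_closed.
    by move=> x _; case: ee => _ ects _; exact: ects.
  have CU : C `<=` U.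
    by move=> x Cx /level_setP [s [_ nh Fs]]; apply: nh; exists x.
  apply: le_trans (content_outer_le k_ge0 kUd k_le1 oU CU) _.
  apply: inner_content_le => // L cL LU.
  have c (x : R) (i : nat) : x <= x <= x by rewrite lexx.
  rewrite -[leRHS](@ulim_cst _ _ G UG); apply: (ulim_le (d01 L) (c _)).
  have : \forall i \near G, (n <= i)%N by apply: subG; exact: nbhs_infty_ge.
  apply: filterS => i /subnKC <-; apply: dens_trunc => w /= sw /LU Uw.
  apply: contrapT => nh; apply: Uw; apply/level_setP.
  have nw : (n <= size w)%N by rewrite sw add0n leq_addr.
  exists (take n w); split => //; first by rewrite size_takel.
  have -> : take n w = mkseq (pad w) n.
    apply: (@eq_from_nth _ false); first by rewrite size_takel// size_mkseq.
    by move=> j; rewrite size_takel// => jn; rewrite nth_take// nth_mkseq.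
  exact: Hphi.
- have bC0 : borel C0 by exact: borel_closed (compact_closed hX cC0).
  have := ro_cara rm bC0 setT; rewrite setTI setTD (ro_setT rm).
  have := content_outer_compact k_ge0 kUd k_le1 cC0; rewrite kC0.
  have := ro_ge0 rm (~` C0); rewrite -/C0; lra.
Qed.

End TreeMeasure.

(** * A parity set in the Cantor space *)

Section Parity.
Implicit Types (eps rho : nat -> bool).

Definition flip (n : nat) eps : nat -> bool := fun i => if i == n then ~~ eps i else eps i.

Let tail_eq eps rho := exists N, forall i, (N <= i)%N -> eps i = rho i.

Let par rho eps N := foldr addb false (mkseq (fun i => eps i (+) rho i) N).

Let parS rho eps N : par rho eps N.+1 = par rho eps N (+) (eps N (+) rho N).
Proof.
rewrite /par mkseqS; elim: (mkseq _ _) => [|b s IH] /=; first by rewrite addbF.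
by rewrite IH addbA.
Qed.

Let par_stable rho eps N N' : (N <= N')%N ->
  (forall i, (N <= i)%N -> eps i = rho i) -> par rho eps N' = par rho eps N.
Proof.
move=> /subnK <- H; elim: (N' - N)%N => [//|k IH].
by rewrite addSn parS IH H ?leq_addl// addbb addbF.
Qed.

Let par_flip rho eps n N : par rho (flip n eps) N = par rho eps N (+) (n < N)%N.
Proof.
elim: N => [|N IH] //.
rewrite !parS IH /flip ltnS [(n <= N)%N]leq_eqVlt [n == N]eq_sym.
case: eqVneq => [->|_] /=; last first.
  by case: (par rho eps N) (n < N)%N (eps N) (rho N) => [] [] [] [].
by rewrite ltnn; case: (par rho eps n) (eps n) (rho n) => [] [] [].
Qed.

(** Choose a representative in each class of eventually equal sequences; [P] holds if the number of
    differences from the representative is odd. A flip keeps the class and changes this number by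
    one. *)
Lemma parity_set : exists P : set (nat -> bool), forall eps n, P (flip n eps) <-> ~ P eps.
Proof.
pose r eps := xget (fun=> false) [set rho | tail_eq eps rho].
have rE eps : tail_eq eps (r eps).
  by apply: (@xgetPex _ (fun=> false) [set rho | tail_eq eps rho]); exists eps, 0%N.
have rF n eps : r (flip n eps) = r eps.
  rewrite /r; congr xget; apply/seteqP; split=> rho [N HN];
    exists (maxn N n.+1) => i; rewrite geq_max => /andP[Ni ni];
    have := HN i Ni; rewrite /flip gtn_eqF//.
pose P eps := exists2 N, (forall i, (N <= i)%N -> eps i = r eps i) & par (r eps) eps N.
have PE eps N : (forall i, (N <= i)%N -> eps i = r eps i) -> P eps <-> par (r eps) eps N.
  move=> HN; split=> [[M HM]|]; last by exists N.
  have [MN|/ltnW NM] := leqP M N; first by rewrite (par_stable MN).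
  by rewrite (par_stable NM).
exists P => eps n.
have [N0 HN0] := rE eps; pose N := maxn N0 n.+1.
have nN : (n < N)%N by exact: leq_maxr.
have HN i : (N <= i)%N -> eps i = r eps i.
  by move=> Ni; apply: HN0; apply: leq_trans Ni; exact: leq_maxl.
have HN' i : (N <= i)%N -> flip n eps i = r (flip n eps) i.
  move=> Ni; rewrite rF -HN// /flip gtn_eqF//; exact: leq_trans Ni.
rewrite (PE _ N)// (PE _ N)// rF par_flip nN addbT.
by split=> [/negP|/negP].
Qed.

End Parity.

Section TreePair.
Context {R : realType} {X K : topologicalType} {e : X -> K}.
Hypothesis cK : compact [set: K].
Hypothesis hK : hausdorff_space K.
Hypothesis ee : embedding e.
Variable F : seq bool -> set K.
Hypothesis cF : forall s, closed (F s).
Hypothesis Fd : forall s b, F (rcons s b) `<=` F s.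

Local Notation Phi := (@branch_set X K e F).
Local Notation hits := (@hits X K e F).

Lemma hits_branch (C : set X) eps : compact C ->
  (forall n, hits C (mkseq eps n)) -> exists2 x, C x & Phi eps x.
Proof.
move=> cC hC.
have ceC : closed (e @` C).
  apply: compact_closed => //; apply: continuous_compact => //.
  by apply: continuous_subspaceT; case: ee.
have [ | | |z Fz] := @compact_nested _ cK (fun n => F (mkseq eps n) `&` e @` C).
- by move=> n; apply: closedI.
- by move=> n; have [x Cx Fx] := hC n; exists (e x); split => //; exists x.
- by move=> n z [Fz Cz]; split => //; move: Fz; rewrite mkseqS; exact: Fd.
have [_ [x Cx xz]] := Fz 0%N; exists x => // n.
by rewrite xz; case: (Fz n).
Qed.

Lemma tree_pair (m : set X -> R) (C : set X) :
  (forall C n, compact C -> m C <= dens (hits C) n [::]) ->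
  compact C -> 0 < m C -> exists eps n, [/\ eps n = false,
    (exists2 x, C x & Phi eps x) & exists2 x, C x & Phi (flip n eps) x].
Proof.
move=> mC cC C0.
have tC : tree (hits C) by exact: hits_tree.
have [s [om Hom]] := tree_steinhaus tC C0 (fun n => mC C n cC).
(* The branch that runs through [s], takes the bit [b] and then follows [om]. *)
pose br b i := nth (om (i - (size s).+1)%N) (rcons s b) i.
have brE b n : mkseq (br b) ((size s).+1 + n) = rcons s b ++ mkseq om n.
  apply: (@eq_from_nth _ false).
    by rewrite size_mkseq size_cat size_rcons size_mkseq.
  move=> i; rewrite size_mkseq => ni; rewrite nth_mkseq// nth_cat /br.
  rewrite size_rcons; case: ltnP => si; first by apply: set_nth_default; rewrite size_rcons.
  rewrite nth_default ?size_rcons// nth_mkseq// ltn_subLR//.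
have pre b n : hits C (mkseq (br b) n).
  have : hits C (mkseq (br b) ((size s).+1 + n)).
    by rewrite brE; case: b; [case: (Hom n)|case: (Hom n)].
  elim: (size s).+1 => [//|k IH]; rewrite addSn mkseqS => /tC; exact: IH.
exists (br false), (size s); split.
- by rewrite /br nth_rcons ltnn eqxx.
- exact: hits_branch.
- have -> : flip (size s) (br false) = br true.
    apply/funext => i; rewrite /flip /br !nth_rcons.
    by case: ltngtP => //= _; rewrite subnn.
  exact: hits_branch.
Qed.

End TreePair.

(** * Cells of positive measure *)

Section TreeCell.
Context {R : realType} {X K : topologicalType} {Y : topgroup} {e : X -> K} {h : X -> Y}.
Hypothesis cK : compact [set: K].
Hypothesis hK : hausdorff_space K.
Hypothesis ee : embedding e.
Hypothesis um : universally_measurable_fun R h.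
Variable F : seq bool -> set K.
Hypothesis cF : forall s, closed (F s).
Hypothesis F0 : forall s, F s !=set0.
Hypothesis Fd : forall s b, F (rcons s b) `<=` F s.
Hypothesis Fr : forall eps z, (forall n, F (mkseq eps n) z) -> range e z.

Local Notation Phi := (@branch_set X K e F).

Variable V : nat -> set Y.
Hypothesis cV : nbhs_chain V.
Hypothesis sat : forall eps x x' k, Phi eps x -> Phi eps x' -> V k ((h x)^v ** h x').

Let hX : hausdorff_space X. Proof. exact: embedding_hausdorff hK ee. Qed.

Section NullCells.
Variable m : set X -> R.
Hypothesis rm : radon_outer m.
Hypothesis mPhi : m (~` \bigcup_eps Phi eps) = 0.
Hypothesis null : forall y, m [set x | V 1 (y^v ** h x)] = 0.

(** The shift by 2 makes a Stone ball together with its thickening fit into one translate of [V 1],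
    which has a null preimage. *)
Let V2 i : set Y := V (i + 2)%N.
Let cV2 : nbhs_chain V2. Proof. exact: chain_add. Qed.

Section Pieces.
Variable n : nat.
Let E (s : Y) : set Y := stone_piece V2 [set \e] n s.
(** Open thickenings of the Stone pieces: of the gap [n.+2] between the pieces, a gap [n.+4] is
    left. *)
Let G (s : Y) : set Y := [set y | exists2 z, E s z & V2 n.+4 (z^v ** y)].

Let openG (S : set Y) : open (\bigcup_(s in S) G s).
Proof.
apply: bigcup_open => s _.
rewrite (_ : G s = \bigcup_(z in E s) [set y | V2 n.+4 (z^v ** y)]).
  apply: bigcup_open => z _; apply: open_comp (chain_open cV2 _) => x _.
  exact: tmul_l_cts.
by apply/seteqP; split=> y; [move=> [z]; exists z|move=> [z]; exists z].
Qed.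

Let sepG s s' y y' : G s y -> G s' y' -> V2 n.+4 (y^v ** y') -> s = s'.
Proof.
move=> [z Ez Vz] [z' Ez' Vz'] Vy; apply: (stone_piece_sep cV2 Ez Ez').
have -> : z^v ** z' = (z^v ** y) ** ((y^v ** y') ** (z'^v ** y')^v) by rewrite !tgE.
apply: (chainM cV2); first exact: (chainS cV2).
by apply: (chainM cV2) => //; exact: (chainV cV2).
Qed.

Let disG s s' y : G s y -> G s' y -> s = s'.
Proof. by move=> Gs Gs'; apply: (sepG Gs Gs'); rewrite tmulV; exact: (chain1 cV2). Qed.

Let nullG s : m (h @^-1` G s) = 0.
Proof.
apply/eqP; rewrite eq_le (ro_ge0 rm) andbT -(null s).
apply: (ro_le rm) => x [z [[g -> Bz] _] Vz] /=; rewrite tmul1 in Bz.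
have -> : s^v ** h x = (s^v ** z) ** (z^v ** h x) by rewrite !tgE.
apply: (chainM cV); first exact: (stone_ball_sub cV2 Bz).
by apply: (chain_le cV) Vz; rewrite addnC.
Qed.

Let relevant s := exists eps x, Phi eps x /\ G s (h x).

(** Each relevant cell is labelled by a branch that meets it. By [sat] and [sepG] a branch meets at
    most one cell, so labels determine relevant cells. *)
Let idx_ex : exists idx : Y -> nat -> bool, forall s, relevant s ->
  exists2 x, Phi (idx s) x & G s (h x).
Proof.
suff H s : exists eps, relevant s -> exists2 x, Phi eps x & G s (h x).
  by have [idx Hidx] := choice H; exists idx.
have [[eps [x [Px Gx]]]|nr] := pselect (relevant s); last by exists (fun=> true).
by exists eps => _; exists x.
Qed.

Let good (C : set X) (S : set Y) : Prop :=
  [/\ compact C, 0 < m C & C `<=` h @^-1` (\bigcup_(s in S) G s)].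

(* Every set of cells has a measurable preimage.  The cells that matter are
   indexed by points of the Cantor space, so if no bit of the index split the
   measure, it would be concentrated on a single null cell. *)
Let split_good C S : good C S -> exists C' : bool -> set X, exists S' : bool -> set Y,
  [/\ forall b, good (C' b) (S' b), forall b, C' b `<=` C, forall b, S' b `<=` S &
      S' false `&` S' true = set0].
Proof.
move=> [cC C0 CS]; have [idx Hidx] := idx_ex.
pose Sb i b := [set s | S s /\ idx s i = b].
pose Ob i b := \bigcup_(s in Sb i b) G s.
have bC : borel C by exact: borel_closed (compact_closed hX cC).
have [[i Hi]|H] := pselect (exists i, forall b, 0 < m (h @^-1` (Ob i b) `&` C)).
  have HC b : exists D, [/\ compact D, D `<=` h @^-1` (Ob i b) `&` C & 0 < m D].
    apply: (mu_measurable_inner rm) => //; apply: um; last exact: ro_prob.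
    exact: openG.
  have [C' HC'] := choice HC.
  exists C', (Sb i); split.
  - by move=> b; have [cD DO D0] := HC' b; split => // x /DO[].
  - by move=> b; have [_ DO _] := HC' b => x /DO[].
  - by move=> b s [].
  - by rewrite -subset0 => s [[_ E0] [_]]; rewrite E0.
exfalso.
have Hb i : exists b, m (h @^-1` (Ob i b) `&` C) = 0.
  apply: contrapT => Hi; apply: H; exists i => b.
  rewrite lt_neqAle (ro_ge0 rm) andbT eq_sym; apply/eqP => E0.
  by apply: Hi; exists b.
have [beta Hbeta] := choice Hb.
(* Up to a null set, every point of [C] lies in a cell whose label disagrees with [beta] at each
   bit. Only one cell can have this label, and it is null as well. *)
pose L := [set x | exists s, [/\ relevant s, idx s = (fun i => ~~ beta i) & G s (h x)]].
have L0 : m L = 0.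
  have [[s [rs ids]]|nL] := pselect (exists s, relevant s /\ idx s = (fun i => ~~ beta i)).
    apply/eqP; rewrite eq_le (ro_ge0 rm) andbT -(nullG s).
    apply: (ro_le rm) => x [s' [rs' ids' Gx]] /=.
    have [x1 P1 G1] := Hidx s rs; have [x2 P2 G2] := Hidx s' rs'.
    rewrite ids in P1; rewrite ids' in P2.
    by rewrite (sepG G1 G2 (sat _ P1 P2)).
  rewrite (_ : L = set0) ?(ro_set0 rm)// -subset0 => x [s [rs ids _]].
  by apply: nL; exists s.
have : m C <= 0; last by rewrite leNgt C0.
have B0 : m (\bigcup_i (h @^-1` (Ob i (beta i)) `&` C)) = 0.
  exact: radon_bigcup_count.
have -> : 0 = m (\bigcup_i (h @^-1` (Ob i (beta i)) `&` C)) +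
    (m (~` \bigcup_eps Phi eps) + m L).
  by rewrite B0 mPhi L0 !addr0.
apply: (le_trans _ (lerD (lexx _) (ro_setU rm _ _))).
apply: le_trans (ro_setU rm _ _); apply: (ro_le rm) => x Cx.
have [[eps _ Px]|nP] := pselect ((\bigcup_eps Phi eps) x); last by right; left.
have [s Ss Gx] := CS x Cx.
have rs : relevant s by exists eps, x.
have [[i Ei]|nE] := pselect (exists i, idx s i = beta i).
  by left; exists i => //; split => //; exists s.
right; right; exists s; split => //; apply/funext => i.
by case E1 : (idx s i); case E2 : (beta i) => //; case: nE; exists i; rewrite E1 E2.
Qed.

(** Repeated splitting gives a new tree of compact sets on which [h] separates the branches
    uniformly. For a parity set of branches, [tree_pair] forbids both the corresponding preimage and
    its complement to have positive measure. *)
Let no_good C S : ~ good C S.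
Proof.
move=> gCS.
have stepP (st : set X * set Y) : exists nx : bool -> set X * set Y, good st.1 st.2 ->
    [/\ forall b, good (nx b).1 (nx b).2, forall b, (nx b).1 `<=` st.1,
      forall b, (nx b).2 `<=` st.2 & (nx false).2 `&` (nx true).2 = set0].
  have [/split_good [C' [S' H]]|ng] := pselect (good st.1 st.2).
    by exists (fun b => (C' b, S' b)).
  by exists (fun=> st).
have [nx Hnx] := choice stepP.
pose st s := foldl nx (C, S) s.
have stS s b : st (rcons s b) = nx (st s) b by rewrite /st foldl_rcons.
have gst s : good (st s).1 (st s).2.
  elim/last_ind: s => [//|s b IH]; rewrite stS.
  by have [H _ _ _] := Hnx _ IH; exact: H.
pose F' s := e @` (st s).1.
have cF' s : closed (F' s).
  apply: compact_closed => //; apply: continuous_compact; last by case: (gst s).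
  by apply: continuous_subspaceT; case: ee.
have F'0 s : F' s !=set0.
  have [_ + _] := gst s; have [[x Cx] _|n0] := pselect ((st s).1 !=set0).
    by exists (e x), x.
  rewrite (_ : (st s).1 = set0) ?(ro_set0 rm) ?ltxx//.
  by rewrite -subset0 => x Cx; apply: n0; exists x.
have F'd s b : F' (rcons s b) `<=` F' s.
  apply: image_subset; rewrite stS; have [_ H _ _] := Hnx _ (gst s); exact: H.
have F'r eps z : (forall n, F' (mkseq eps n) z) -> range e z.
  by move=> /(_ 0%N) [x _ <-]; exists x.
have [m' [rm' mC' _]] := @tree_measure R _ _ _ cK hK ee F' cF' F'0 F'd F'r.
pose Phi' := @branch_set X K e F'.
have PhiS eps x s : Phi' eps x -> G s (h x) -> forall k, (st (mkseq eps k)).2 s.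
  move=> Px Gs k; have [x' Cx' xx'] := Px k.
  have E1 : x' = x by case: ee => inj _ _; exact: inj.
  rewrite E1 in Cx'; have [_ _ CS'] := gst (mkseq eps k).
  by have [s' Ss' Gs'] := CS' _ Cx'; rewrite (disG Gs Gs').
have uniq eps eps' x x' : Phi' eps x -> Phi' eps' x' ->
    V2 n.+4 ((h x)^v ** h x') -> eps = eps'.
  move=> Px Px' Vx.
  have [x0 Cx0 xx0] := Px 0%N; have [x0' Cx0' xx0'] := Px' 0%N.
  have E1 : x0 = x by case: ee => inj _ _; exact: inj.
  have E2 : x0' = x' by case: ee => inj _ _; exact: inj.
  have [_ _ CS'] := gst [::].
  have [s _ Gs] := CS' _ Cx0; have [s' _ Gs'] := CS' _ Cx0'.
  rewrite E1 in Gs; rewrite E2 in Gs'.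
  have ss' := sepG Gs Gs' Vx; rewrite -ss' in Gs'.
  have H := PhiS _ _ _ Px Gs; have H' := PhiS _ _ _ Px' Gs'.
  have mkE k : mkseq eps k = mkseq eps' k.
    elim: k => [//|k IH]; rewrite !mkseqS -IH; congr rcons.
    have := H k.+1; have := H' k.+1; rewrite !mkseqS -IH !stS.
    have [_ _ _ dis] := Hnx _ (gst (mkseq eps k)).
    case: (eps k); case: (eps' k) => // S1 S2.
      by case: (eq_set0P (x := s) dis).
    by case: (eq_set0P (x := s) dis).
  apply/funext => k; have := congr1 (fun t => nth false t k) (mkE k.+1).
  by rewrite !nth_mkseq.
have [P HP] := parity_set.
(* By [uniq] the thickened images of different branches do not mix, so on the tree the preimage of
   [W] consists of exactly the branches in [P]. *)
pose W := \bigcup_(q in [set q | P q.1 /\ Phi' q.1 q.2])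
  [set y | V2 n.+4 ((h q.2)^v ** y)].
have oW : open W.
  apply: bigcup_open => q _; apply: open_comp (chain_open cV2 _) => x _.
  exact: tmul_l_cts.
have PW eps x : Phi' eps x -> W (h x) <-> P eps.
  move=> Px; split=> [[[eps' x'] /= [Pe Px'] Vx]|Pe].
    by rewrite -(uniq _ _ _ _ Px' Px Vx).
  by exists (eps, x) => //=; rewrite tmulV; exact: (chain1 cV2).
have mW := um oW (ro_prob rm').
have bT : borel [set: X] by apply: borel_open; exact: openT.
have pair := tree_pair cK hK ee cF' F'd mC'.
have [W0|W0] := ltP 0 (m' (h @^-1` W)).
  have [|D [cD DW D0]] := mu_measurable_inner rm' mW bT; first by rewrite setIT.
  have [eps [k [_ [x Dx Px] [x' Dx' Px']]]] := pair _ cD D0.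
  have [Wx _] := DW _ Dx; have [Wx' _] := DW _ Dx'.
  by have /HP := (PW _ _ Px').1 Wx'; apply; exact: (PW _ _ Px).1.
have [|D [cD DW D0]] := mu_measurable_inner rm' (mu_measurableC mW) bT.
  rewrite setIT; have := ro_setU rm' (h @^-1` W) (~` (h @^-1` W)).
  by rewrite setUv (ro_setT rm'); lra.
have [eps [k [_ [x Dx Px] [x' Dx' Px']]]] := pair _ cD D0.
have [Wx _] := DW _ Dx; have [Wx' _] := DW _ Dx'.
apply: Wx'; apply/(PW _ _ Px')/HP => Pe.
by apply: Wx; apply/(PW _ _ Px).
Qed.

Lemma pieces_null : m (h @^-1` (\bigcup_s G s)) = 0.
Proof.
apply/eqP; rewrite eq_le (ro_ge0 rm) andbT leNgt; apply/negP => G0.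
have bT : borel [set: X] by apply: borel_open; exact: openT.
have [|D [cD DW D0]] := mu_measurable_inner rm (um (openG setT) (ro_prob rm)) bT.
  by rewrite setIT.
by apply: (@no_good D setT); split => // x /DW[].
Qed.

End Pieces.

Lemma null_cells_false : False.
Proof.
have : 0 < m setT by rewrite (ro_setT rm).
move=> /(radon_bigcup_gt0 rm (F := fun n => h @^-1` (\bigcup_s
   [set y | exists2 z, stone_piece V2 [set \e] n s z & V2 n.+4 (z^v ** y)]))) [].
  move=> x _; have [n [s Es]] := stone_piece_cover cV2 (Gam := [set \e]) (h x) erefl.
  by exists n => //; exists s => //; exists (h x) => //; rewrite tmulV; exact: (chain1 cV2).
by move=> n; rewrite setTI pieces_null ltxx.
Qed.

End NullCells.

(** Since [null_cells_false] yields a translate of [V 1] with preimage of positive measure,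
    [tree_pair] finds in it two branches that differ in one bit. *)
Theorem tree_cell : exists eps n, [/\ eps n = false &
  exists x x', [/\ Phi eps x, Phi (flip n eps) x' & V 0%N ((h x)^v ** h x')]].
Proof.
have [m [rm mC mPhi]] := @tree_measure R _ _ _ cK hK ee F cF F0 Fd Fr.
have [y my] : exists y, 0 < m [set x | V 1 (y^v ** h x)].
  apply: contrapT => H; apply: (null_cells_false rm mPhi) => y.
  apply/eqP; rewrite eq_le (ro_ge0 rm) andbT leNgt; apply/negP => my.
  by apply: H; exists y.
have oy : open [set z | V 1 (y^v ** z)].
  by apply: open_comp (chain_open cV _) => x _; exact: tmul_l_cts.
have bT : borel [set: X] by apply: borel_open; exact: openT.
have [|D [cD DW D0]] := mu_measurable_inner rm (um oy (ro_prob rm)) bT.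
  by rewrite setIT.
have [eps [n [en [x Dx Px] [x' Dx' Px']]]] := tree_pair cK hK ee cF Fd mC cD D0.
have [Vx _] := DW _ Dx; have [Vx' _] := DW _ Dx'.
exists eps, n; split => //; exists x, x'; split => //.
have -> : (h x)^v ** h x' = (y^v ** h x)^v ** (y^v ** h x') by rewrite !tgE.
by apply: (chainM cV) => //; exact: (chainV cV).
Qed.

End TreeCell.

(** * The game *)

Section Game.
Context {R : realType} {X Y : topgroup} {K : topologicalType} {e : X -> K} {h : X -> Y}.
Hypothesis cK : compact [set: K].
Hypothesis hK : hausdorff_space K.
Hypothesis ee : embedding e.
Variable G : nat -> set K.
Hypothesis oG : forall n, open (G n).
Hypothesis eG : range e = \bigcap_n G n.
Hypothesis hom : forall x y, h (x ** y) = h x ** h y.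
Hypothesis um : universally_measurable_fun R h.

Let hX : hausdorff_space X. Proof. exact: embedding_hausdorff hK ee. Qed.
Let ects : continuous e. Proof. by case: ee. Qed.

Lemma embedding_closure (A : set X) x : closure (e @` A) (e x) -> closure A x.
Proof.
move=> cl B Bx; have [V oV [Vx VB]] := embedding_nbhs ee Bx.
have [_ [[a Aa <-] Va]] := cl V (open_nbhs_nbhs (conj oV Vx)).
by exists a; split => //; exact: VB.
Qed.

Lemma gdelta_nbhs n (x : X) : exists2 A, nbhs x A & closure (e @` A) `<=` G n.
Proof.
have Gx : nbhs (e x) (G n).
  apply: open_nbhs_nbhs; split => //.
  by have : range e (e x) by []; rewrite eG; apply.
have [|B Bx BG] := @compact_regular K (e x) setT hK cK _ (G n) Gx.
  exact: filterT.
exists (e @^-1` B); first exact: ects.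
by apply: subset_trans BG; apply: closure_subset; exact: image_preimage_subset.
Qed.

Variable V : nat -> set Y.
Hypothesis cV : nbhs_chain V.

(* The intersection of a suitable chain is a compact subgroup, on which [h] is
   continuous; hence the chain can be refined so that [h] maps its
   intersection into every [V k]. *)
Lemma base_chain : exists2 W : nat -> set X, nbhs_chain W &
  forall g, (forall n, W n g) -> forall k, V k (h g).
Proof.
have [A HA] := choice (fun n => let: ex_intro2 A An AG := gdelta_nbhs n \e in
  ex_intro (fun A => nbhs (\e : X) A /\ closure (e @` A) `<=` G n) A (conj An AG)).
have [W0 cW0 W0A] := nbhs_chain_below (fun n => (HA n).1).
pose H := \bigcap_n W0 n.
(* The closure of [W0 n.+1] in [X] lies in [W0 n], so closures do not enlarge the intersection. *)
have HE : H = e @^-1` (\bigcap_n closure (e @` W0 n)).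
  apply/seteqP; split=> x Hx n _.
    by apply: subset_closure; exists x => //; exact: Hx.
  have cvx : (fun a => x^v ** a) @ x --> x^v ** x by tcvg.
  have Bx : nbhs x [set a | W0 n.+1 (x^v ** a)].
    by apply: cvx; rewrite tmulV; exact: chain_nbhs.
  have [a [Wa Wxa]] := embedding_closure (Hx n.+1 I) Bx.
  have -> : x = a ** (x^v ** a)^v by rewrite !tgE.
  by apply: (chainM cW0) => //; exact: (chainV cW0).
have cH : compact H.
  rewrite HE; apply: (embedding_compact cK ee).
    by apply: closed_bigI => n _; exact: closed_closure.
  rewrite eG => z Hz n _; apply: (HA n).2.
  by apply: closure_subset (Hz n I); exact: image_subset (W0A n).
have H1 : H \e by move=> n _; exact: (chain1 cW0).
have HM x y : H x -> H y -> H (x ** y).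
  by move=> Hx Hy n _; apply: (chainM cW0); [exact: Hx|exact: Hy].
have HV x : H x -> H x^v by move=> Hx n _; apply: (chainV cW0); exact: Hx.
have U1 n : nbhs (\e : X) (W0 n `&` [set g | H g -> V n (h g)]).
  apply: filterI; first exact: chain_nbhs.
  exact: (compact_subgroup_continuous hX hom um cH H1 HM HV (chain_nbhs cV n)).
have [W cW WU] := nbhs_chain_below U1.
exists W => // g Wg k; have [_] := WU k g (Wg k); apply => n _.
by have [] := WU n g (Wg n).
Qed.

Definition prefix_products (l : seq X) : seq X :=
  foldl (fun ts f => ts ++ [seq f ** t | t <- ts]) [:: \e] l.

(** Later factors stand on the left; the second component of the fold is the index of the next
    factor. *)
Definition tprod (f : nat -> X) (s : seq bool) : X :=
  (foldl (fun p (b : bool) => ((if b then f p.2 else \e) ** p.1, p.2.+1)) (\e, 0%N) s).1.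

Lemma tprodS f s b : tprod f (rcons s b) = (if b then f (size s) else \e) ** tprod f s.
Proof.
rewrite /tprod foldl_rcons /=; congr ((if b then f _ else _) ** _).
by elim/last_ind: s => [//|s c IH]; rewrite foldl_rcons size_rcons /= IH.
Qed.

Lemma tprod_prefix f s : tprod f s \in prefix_products (mkseq f (size s)).
Proof.
elim/last_ind: s => [|s b IH]; first by rewrite inE.
rewrite size_rcons mkseqS /prefix_products foldl_rcons mem_cat tprodS.
by case: b; rewrite ?tmul1 ?IH// map_f ?orbT.
Qed.

Section Strategy.
Variable W : nat -> set X.
Hypothesis cW : nbhs_chain W.
Hypothesis WV : forall g, (forall n, W n g) -> forall k, V k (h g).

(** The first clause keeps the limits of branches in the range of [e]; by the second, points on one
    branch differ by an element of every [W n], so [WV] controls [h] there. *)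
Let small n (t : X) (A : set X) := closure (e @` [set w ** t | w in A]) `<=` G n /\
  forall w w', A w -> A w' -> W n.+2 (t^v ** (w^v ** (w' ** t))).

Let small_sub n t A B : A `<=` B -> small n t B -> small n t A.
Proof.
move=> AB [B1 B2]; split; last by move=> w w' /AB Bw /AB Bw'; exact: B2.
by apply: subset_trans B1; apply: closure_subset; apply: image_subset; exact: image_subset.
Qed.

Let small_ex n t : exists2 A, nbhs \e A & small n t A.
Proof.
have [B Bt BG] := gdelta_nbhs n t.
have cv1 : (fun w => w ** t) @ (\e : X) --> \e ** t by tcvg.
have B1 : nbhs (\e : X) [set w | B (w ** t)] by apply: cv1; rewrite tmul1.
have cv2 : (fun w => t^v ** (w ** t)) @ (\e : X) --> t^v ** (\e ** t) by tcvg.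
have [|D D1 HD] := @nbhs1_div X [set w | W n.+2 (t^v ** (w ** t))].
  by apply: cv2; rewrite !tgE; exact: chain_nbhs.
exists ([set w | B (w ** t)] `&` D); first exact: filterI.
split.
  apply: subset_trans BG; apply: closure_subset; apply: image_subset.
  by move=> _ [w [Bw _] <-].
by move=> w w' [_ Dw] [_ Dw']; have := HD _ _ Dw Dw'; rewrite /= !tgE.
Qed.

(** The last two clauses nest the cells of the tree for the bits 0 and 1. Legality [A f] is assumed
    only in the last one, so that the strategy answers every history. *)
Let next_ex (l : seq X) (A : set X) (f : X) : exists B : set X, open A -> A \e ->
  [/\ open B, B \e, forall t, t \in prefix_products (rcons l f) ->
       small (size l).+1 t B,
     B `<=` A & A f -> forall w, B w -> A (w ** f)].
Proof.
have [oA|noA] := pselect (open A); last by exists setT.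
have [Ae|nAe] := pselect (A \e); last by exists setT.
have [D HD] : exists D : X -> set X, forall t, nbhs \e (D t) /\ small (size l).+1 t (D t).
  suff H t : exists D, nbhs \e D /\ small (size l).+1 t D.
    by have [D HD] := choice H; exists D.
  by have [D] := small_ex (size l).+1 t; exists D.
pose B0 := [set w | forall t, t \in prefix_products (rcons l f) -> D t w].
have B01 : nbhs (\e : X) B0 by apply: filter_seq => t _; exact: (HD t).1.
have B11 : nbhs (\e : X) [set w | A f -> A (w ** f)].
  have [Af|nAf] := pselect (A f); last by apply: filterE => w /nAf.
  have cv1 : (fun w => w ** f) @ (\e : X) --> \e ** f by tcvg.
  have cvA : nbhs (\e : X) [set w | A (w ** f)].
    by apply: cv1; rewrite tmul1; exact: open_nbhs_nbhs.
  by apply: filterS cvA => w Aw _; exact: Aw.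
have A1 : nbhs (\e : X) A by exact: open_nbhs_nbhs.
exists (B0 `&` [set w | A f -> A (w ** f)] `&` A)° => _ _.
have sub := @interior_subset _ (B0 `&` [set w | A f -> A (w ** f)] `&` A).
split.
- exact: open_interior.
- by apply: nbhs_singleton; apply/nbhs_interior; apply: filterI => //; exact: filterI.
- move=> t tl; apply: small_sub (HD t).2 => w /sub [[B0w _] _]; exact: B0w.
- by move=> w /sub [].
- by move=> Af w /sub [[_ +] _]; apply.
Qed.

Lemma strategy_ex : exists sig : seq X -> set X,
  [/\ forall l, open (sig l), forall l, sig l \e,
      forall l t, t \in prefix_products l -> small (size l) t (sig l),
      forall l f, sig (rcons l f) `<=` sig l &
      forall l f, sig l f -> forall w, sig (rcons l f) w -> sig l (w ** f)].
Proof.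
have [nx Hnx] : exists nx : seq X * set X * X -> set X,
  forall q, open q.1.2 -> q.1.2 \e ->
  [/\ open (nx q), nx q \e, forall t, t \in prefix_products (rcons q.1.1 q.2) ->
       small (size q.1.1).+1 t (nx q),
     nx q `<=` q.1.2 & q.1.2 q.2 -> forall w, nx q w -> q.1.2 (w ** q.2)].
  suff H (q : seq X * set X * X) : exists B, open q.1.2 -> q.1.2 \e ->
    [/\ open B, B \e, forall t, t \in prefix_products (rcons q.1.1 q.2) ->
       small (size q.1.1).+1 t B,
     B `<=` q.1.2 & q.1.2 q.2 -> forall w, B w -> q.1.2 (w ** q.2)].
    by have [nx Hnx] := choice H; exists nx.
  exact: next_ex.
have [A0 A01 sA0] := small_ex 0 \e.
pose st l := foldl (fun p f => (rcons p.1 f, nx (p, f))) ([::], A0°) l.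
have stE l f : st (rcons l f) = (rcons (st l).1 f, nx (st l, f)).
  by rewrite /st foldl_rcons.
have st1 l : (st l).1 = l.
  by elim/last_ind: l => [//|l f IH]; rewrite stE /= IH.
have oe l : open (st l).2 /\ (st l).2 \e.
  elim/last_ind: l => [|l f [IH1 IH2]].
    split; first exact: open_interior.
    exact: nbhs_singleton (nbhs_interior _).
  by rewrite stE /=; have [] := Hnx (st l, f) IH1 IH2.
exists (fun l => (st l).2); split.
- by move=> l; case: (oe l).
- by move=> l; case: (oe l).
- move=> l; case/lastP: l => [|l f] t.
    by rewrite inE => /eqP ->; apply: small_sub sA0; exact: interior_subset.
  rewrite stE size_rcons /=; have [p1 e1] := oe l.
  by have [_ _ + _ _] := Hnx (st l, f) p1 e1; rewrite /= st1; exact.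
- by move=> l f; rewrite stE /=; have [p1 e1] := oe l; have [] := Hnx (st l, f) p1 e1.
- by move=> l f; rewrite stE /=; have [p1 e1] := oe l; have [] := Hnx (st l, f) p1 e1.
Qed.

End Strategy.

(** The cells are the translates of the answers [sig] by the partial products. [tree_cell] gives [x]
    and [x'] on branches that differ in bit [n], with [h x] close to [h x']; then [x'] is compared
    with [x ** c] on the same branch. *)
Lemma game_chain : exists sig : seq X -> set X, (forall l, nbhs \e (sig l)) /\
  forall f, (forall n, sig (mkseq f n) (f n)) ->
    exists s a b, [/\ V 0%N a, V 0%N b &
      h ((tprod f s)^v ** (f (size s) ** tprod f s)) = a ** b].
Proof.
have [W cW WV] := base_chain.
have [sig [osig sig1 sigS sigd sigf]] := strategy_ex cW.
exists sig; split=> [l|f fsig]; first by apply: open_nbhs_nbhs.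
pose A s := [set w ** tprod f s | w in sig (mkseq f (size s))].
pose F s := closure (e @` A s).
have Ad s b : A (rcons s b) `<=` A s.
  move=> _ [w + <-]; rewrite size_rcons mkseqS tprodS => sw.
  case: b; first by exists (w ** f (size s)); rewrite ?tmulA//; exact: sigf.
  by exists w; rewrite ?tmul1//; exact: sigd sw.
have cF s : closed (F s) by exact: closed_closure.
have F0 s : F s !=set0.
  exists (e (\e ** tprod f s)); apply: subset_closure.
  by exists (\e ** tprod f s) => //; exists \e.
have Fd s b : F (rcons s b) `<=` F s.
  by apply: closure_subset; apply: image_subset; exact: Ad.
have sm s := sigS (mkseq f (size s)) (tprod f s) (tprod_prefix f s).
have Fr eps z : (forall n, F (mkseq eps n) z) -> range e z.
  move=> Fz; rewrite eG => n _; have [sub _] := sm (mkseq eps n).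
  by have := sub z (Fz n); rewrite !size_mkseq.
have clA eps x n : branch_set (e := e) F eps x -> closure (A (mkseq eps n)) x.
  by move=> Px; apply: embedding_closure; exact: Px.
have nearx (x : X) n : nbhs x [set a | W n (x^v ** a)].
  have cv : (fun a => x^v ** a) @ x --> x^v ** x by tcvg.
  by apply: cv; rewrite tmulV; exact: chain_nbhs.
have sat eps x x' k : branch_set (e := e) F eps x -> branch_set (e := e) F eps x' ->
    V k ((h x)^v ** h x').
  move=> Px Px'; rewrite -(homV hom) -hom; apply: WV => n.
  have [a [[w sw <-] Wa]] := clA eps x n Px _ (nearx x n.+2).
  have [a' [[w' sw' <-] Wa']] := clA eps x' n Px' _ (nearx x' n.+2).
  set t := tprod f _ in Wa Wa'.
  have -> : x^v ** x' = (x^v ** (w ** t)) **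
      ((t^v ** (w^v ** (w' ** t))) ** (x'^v ** (w' ** t))^v) by rewrite !tgE.
  apply: (chainM cW); first exact: (chainS cW).
  apply: (chainM cW); last exact: (chainV cW).
  by have [_ /(_ w w' sw sw')] := sm (mkseq eps n); rewrite !size_mkseq.
have [eps [n [en [x [x' [Px Px' V0]]]]]] := tree_cell cK hK ee um cF F0 Fd Fr cV sat.
pose s := mkseq eps n; pose c := (tprod f s)^v ** (f n ** tprod f s).
have fs m : (m <= n)%N -> mkseq (flip n eps) m = mkseq eps m.
  move=> mn; apply/eq_in_map => i; rewrite mem_iota add0n => /andP[_ im].
  by rewrite /flip ltn_eqF//; exact: leq_trans mn.
have tc m : tprod f (mkseq (flip n eps) (m + n.+1)) = tprod f (mkseq eps (m + n.+1)) ** c.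
  elim: m => [|m IH]; last first.
    rewrite addSn !mkseqS !tprodS IH !size_mkseq tmulA /flip.
    by rewrite gtn_eqF// addnS ltnS leq_addl.
  rewrite add0n !mkseqS !tprodS fs// !size_mkseq /flip eqxx en /= /c -/s.
  by rewrite !tgE.
(* Beyond bit [n] the products along the two branches have the same left factors, so right
   multiplication by [c] carries one branch into the other. *)
have Pxc : branch_set (e := e) F (flip n eps) (x ** c).
  have big m : F (mkseq (flip n eps) (m + n.+1)) (e (x ** c)).
    move=> B /ects Bx.
    have cv : (fun y => y ** c) @ x --> x ** c by tcvg.
    have [_ [[w sw <-] Bw]] := clA eps x (m + n.+1)%N Px _ (cv _ Bx).
    exists (e (w ** tprod f (mkseq eps (m + n.+1)) ** c)); split => //.
    exists (w ** tprod f (mkseq eps (m + n.+1)) ** c) => //.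
    exists w; last by rewrite tc tmulA.
    by move: sw; rewrite !size_mkseq.
  move=> k; have := big k; rewrite addnC.
  by elim: n.+1 => [//|j IH]; rewrite addSn mkseqS => /Fd; exact: IH.
exists s, ((h x)^v ** h x'), ((h x')^v ** h (x ** c)); split => //.
  exact: sat Px' Pxc.
by rewrite size_mkseq -/c hom !tgE.
Qed.

End Game.

Section GameTheorem.
Context {R : realType} {X Y : topgroup} {h : X -> Y}.
Hypothesis cX : cech_complete X.
Hypothesis hom : forall x y, h (x ** y) = h x ** h y.
Hypothesis um : universally_measurable_fun R h.

(* Two branches of the tree of products that differ in one bit differ by a
   factor that is a conjugate of one of the [f n]. *)
Theorem game (U : set Y) : nbhs \e U ->
  exists sig : seq X -> set X, (forall l, nbhs \e (sig l)) /\
    forall f, (forall n, sig (mkseq f n) (f n)) ->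
      exists n t, t \in prefix_products (mkseq f n) /\ U (h (t^v ** (f n ** t))).
Proof.
move=> /nbhs1_square [W [oW W1 WV WM _]].
have [V cV VW] := nbhs_chain_ex (open_nbhs_nbhs (conj oW W1)).
have [K [e [cK hK ee [G oG eG]]]] := cX.
have [sig [sig1 Hsig]] := game_chain cK hK ee oG eG hom um cV.
exists sig; split=> // f /Hsig [s [a [b [Va Vb hE]]]].
exists (size s), (tprod f s); split; first exact: tprod_prefix.
by rewrite hE; apply: WM; exact: VW.
Qed.

End GameTheorem.

(** * Automatic continuity *)

Section AutomaticContinuity.
Context {R : realType} {X Y : topgroup} {h : X -> Y}.
Hypothesis cX : cech_complete X.
Hypothesis hom : forall x y, h (x ** y) = h x ** h y.
Hypothesis um : universally_measurable_fun R h.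

(** Conjugation by each [t] is a homeomorphism, so [W] can be shrunk once for each element of
    [ts]. *)
Lemma nowhere_dense_avoid (A : set X) (ts : seq X) (W : set X) :
  (closure A)° = set0 -> open W -> W !=set0 ->
  exists2 g, W g & forall t, t \in ts -> ~ A (t^v ** (g ** t)).
Proof.
move=> A0; elim: ts W => [|t ts IH] W oW [w Ww]; first by exists w.
have cvt : continuous (fun g => t ** (g ** t^v)) by move=> x; tcvg.
have cvt' : continuous (fun g => t^v ** (g ** t)) by move=> x; tcvg.
have [z [Wz clz]] : exists z, W (t ** (z ** t^v)) /\ ~ closure A z.
  apply: contrapT => H; apply: (eq_set0P (x := t^v ** (w ** t)) A0).
  have Ww' : nbhs (t^v ** (w ** t)) [set z | W (t ** (z ** t^v))].
    apply: cvt; rewrite !tgE; exact: open_nbhs_nbhs.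
  apply: filterS Ww' => z Wz; apply: contrapT => nclz; by apply: H; exists z.
have [ | |g [Wg nclg] Hg] := IH (W `&` [set g | ~ closure A (t^v ** (g ** t))]).
- apply: openI => //; apply: open_comp (closed_openC (@closed_closure _ A)) => x _.
  exact: cvt'.
- by exists (t ** (z ** t^v)); split => //=; rewrite !tgE.
exists g => // s; rewrite inE => /orP[/eqP -> At|/Hg//].
by apply: nclg; exact: subset_closure.
Qed.

Lemma preimage_dense (U : set Y) : nbhs \e U -> nbhs \e (closure (h @^-1` U)).
Proof.
move=> /nbhs1_div [W W1 WU].
have [[x Ax]|A0] := pselect ((closure (h @^-1` W))° !=set0); last first.
  have [sig [sig1 Hsig]] := game cX hom um W1.
  have [l|f Pf] := @prefix_choice X (fun l g => sig l g /\
      forall t, t \in prefix_products l -> ~ (h @^-1` W) (t^v ** (g ** t))).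
    have [ | | |g Wg Hg] := @nowhere_dense_avoid (h @^-1` W) (prefix_products l) (sig l)°.
    - by rewrite -subset0 => x Ax; apply: A0; exists x.
    - exact: open_interior.
    - by exists \e; apply: nbhs_singleton; apply/nbhs_interior; exact: sig1.
    by exists g; split => //; exact: interior_subset Wg.
  have [|n [t [tl Wt]]] := Hsig f; first by move=> n; case: (Pf n).
  by case: (Pf n) => _ /(_ t tl).
(* An element [a] of the preimage inside the interior of its closure is moved to the identity; there
   the preimage of the quotients of elements of [W] is dense. *)
have [a [Wa Aa]] := interior_subset Ax _ (open_nbhs_nbhs (conj (open_interior _) Ax)).
have cv : (fun g => a ** g) @ (\e : X) --> a ** \e by tcvg.
have N1 : nbhs (\e : X) [set g | closure (h @^-1` W) (a ** g)].
  by apply: cv; rewrite tmulr1.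
apply: filterS N1 => g clag B Bg.
have cv' : (fun y => a^v ** y) @ (a ** g) --> a^v ** (a ** g) by tcvg.
have [|y [Wy By]] := clag [set y | B (a^v ** y)].
  by apply: cv'; rewrite !tgE.
exists (a^v ** y); split => //=; rewrite hom (homV hom).
exact: WU.
Qed.

(** Closeness is required on both sides because both the left and the right quotients of successive
    moves must be small. *)
Let sim (U : set Y) (x : X) : set X :=
  [set y | U (h (x^v ** y)) /\ U (h (y ** x^v))].

Lemma sim_dense (U : set Y) x : nbhs \e U -> nbhs x (closure (sim U x)).
Proof.
move=> U1.
have U1' : nbhs (\e : Y) (U `&` [set z | U (h x ** (z ** (h x)^v))]).
  apply: filterI => //.
  have cv : (fun z => h x ** (z ** (h x)^v)) @ (\e : Y) --> h x ** (\e ** (h x)^v).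
    by tcvg.
  by apply: cv; rewrite !tgE.
have D := preimage_dense U1'.
have cv : (fun y => x^v ** y) @ x --> x^v ** x by tcvg.
rewrite tmulV in cv.
set E := closure _ in D.
have D' : nbhs x [set y | E (x^v ** y)] := cv _ D.
apply: filterS D' => y cly B By.
have cv' : (fun z => x ** z) @ (x^v ** y) --> x ** (x^v ** y) by tcvg.
have [|z [[Uz Uz'] Bz]] := cly [set z | B (x ** z)].
  by apply: cv'; rewrite !tgE.
exists (x ** z); split => //; split; rewrite ?tmulVK//.
by move: Uz'; rewrite /= !hom (homV hom) !tgE.
Qed.

Lemma nbhs1_common (Y' : topgroup) (P : X -> set Y' -> Prop) (ts : seq X) :
  (forall t, exists2 D, nbhs \e D & P t D) ->
  (forall t D D', D `<=` D' -> P t D' -> P t D) ->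
  exists2 D, nbhs \e D & forall t, t \in ts -> P t D.
Proof.
move=> Pex Psub.
have [D HD] : exists D : X -> set Y', forall t, nbhs \e (D t) /\ P t (D t).
  suff H t : exists D, nbhs \e D /\ P t D by have [D HD] := choice H; exists D.
  by have [D] := Pex t; exists D.
exists [set w | forall t, t \in ts -> D t w].
  by apply: filter_seq => t _; exact: (HD t).1.
move=> t tts; apply: Psub (HD t).2 => w; exact.
Qed.

Variable Z : nat -> set Y.
Hypothesis cZ : nbhs_chain Z.
Variable sig : seq X -> set X.
Hypothesis sig1 : forall l, nbhs \e (sig l).

(** With [v] the image of [b^-1 b1], this bounds conjugates by [h (t^-1 b1)], so [B] can be fixed
    before the next [b1] is known. Two factors in [Z (size l + 7)] make a step in [Z (size l + 6)],
    and such steps accumulate within [Z 4]. *)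
Let conj_small (l : seq X) (b : X) (B : set Y) : Prop :=
  forall t v v', t \in prefix_products l -> B v -> B v' ->
    Z (size l + 7)%N (h (t^v ** b) ** (v ** (v' ** (v^v ** (h (t^v ** b))^v)))).

Let conj_small_ex l b : exists2 B, nbhs \e B & conj_small l b B.
Proof.
have [||D D1 HD] := @nbhs1_common Y (fun t B => forall v v', B v -> B v' ->
  Z (size l + 7)%N (h (t^v ** b) ** (v ** (v' ** (v^v ** (h (t^v ** b))^v)))))
  (prefix_products l).
- move=> t; set g := h _.
  have cv : (fun p : Y * Y => g ** (p.1 ** (p.2 ** (p.1^v ** g^v)))) @
      (nbhs (\e : Y), nbhs (\e : Y)) --> g ** (\e ** (\e ** (\e^v ** g^v))).
    by tcvg.
  rewrite !tgE in cv.
  have [[B C] /= [B1 C1] BC] := cv _ (chain_nbhs cZ (size l + 7)%N).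
  exists (B `&` C); first exact: filterI.
  by move=> v v' [Bv _] [_ Cv']; exact: (BC (v, v')).
- by move=> t D D' DD' HD' v v' /DD' Dv /DD' Dv'; exact: HD'.
by exists D => // t v v' /HD; apply.
Qed.

(** The invariant of the play with history [l] and current move [b a^-1]. The sets [A] and [B] limit
    how far [h a] and [h b] may still move, and [W] is the region where both can be changed
    densely. *)
Let good (l : seq X) (a b : X) (W : set X) (A B : set Y) : Prop :=
  [/\ [/\ open W, W b, W `<=` closure (sim A a), W `<=` closure (sim B b) & nbhs \e B],
    forall t v, t \in prefix_products l -> A v ->
      Z (size l + 7)%N ((h t)^v ** (v^v ** h t)) /\
      Z (size l + 7)%N (h (t^v ** b) ** (v ** (h (t^v ** b))^v)),
    forall t v, t \in prefix_products l -> B v ->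
      Z (size l + 7)%N (h (t^v ** a) ** (v ** (h (t^v ** a))^v)) /\
      Z (size l + 7)%N ((h t)^v ** (v ** h t)) &
    conj_small (rcons l (b ** a^v)) b B].

(** First [a] is found in [W] among the points similar to [a0], then [b] among those similar to [b0]
    and so near [a] that [b a^-1] is legal. The quotient shrinks although [h a] and [h b] hardly
    change. *)
Let step l a0 b0 W A0 B0 : open W -> W b0 -> W `<=` closure (sim A0 a0) ->
  W `<=` closure (sim B0 b0) -> nbhs \e B0 -> conj_small l b0 B0 ->
  exists a b W' A B, [/\ sim A0 a0 a, sim B0 b0 b, sig l (b ** a^v) &
    good l a b W' A B].
Proof.
move=> oW Wb0 WA WB B01 cs.
have [a [simA Wa]] := WA b0 Wb0 W (open_nbhs_nbhs (conj oW Wb0)).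
have conj1 (g : Y) k : \forall v \near (\e : Y), Z k (g ** (v ** g^v)).
  have cv : (fun v => g ** (v ** g^v)) @ (\e : Y) --> g ** (\e ** g^v) by tcvg.
  by apply: cv; rewrite !tgE; exact: chain_nbhs.
have conj2 (g : Y) k : \forall v \near (\e : Y), Z k (g^v ** (v ** g)).
  by have := conj1 g^v k; apply: filterS => v; rewrite tinvK.
have [||A1 A11 HA1] := @nbhs1_common Y (fun t A => forall v, A v ->
  Z (size l + 7)%N ((h t)^v ** (v^v ** h t))) (prefix_products l).
- move=> t; exists [set v | Z (size l + 7)%N ((h t)^v ** (v^v ** h t))] => //.
  by have := conj2 (h t) (size l + 7)%N; apply: filterS => v /(chainV cZ); rewrite !tgE.
- by move=> t D D' DD' HD' v /DD'; exact: HD'.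
pose A := A1 `&` B0.
have nA : nbhs \e A by exact: filterI.
have sa : nbhs a [set x | sig l (x ** a^v)].
  have cv : (fun x => x ** a^v) @ a --> a ** a^v by tcvg.
  by apply: cv; rewrite tmulrV.
pose W1 := (W `&` (closure (sim A a) `&` [set x | sig l (x ** a^v)]))°.
have W1a : W1 a.
  apply: nbhs_singleton; apply/nbhs_interior.
  apply: filterI; first exact: open_nbhs_nbhs.
  by apply: filterI => //; exact: sim_dense.
have W1sub := @interior_subset _ (W `&` (closure (sim A a) `&` [set x | sig l (x ** a^v)])).
have [b [simB W1b]] : exists b, sim B0 b0 b /\ W1 b.
  have [b [? ?]] := WB a Wa W1 (open_nbhs_nbhs (conj (open_interior _) W1a)).
  by exists b.
have [||B1 B11 HB1] := @nbhs1_common Y (fun t B => forall v, B v ->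
    Z (size l + 7)%N (h (t^v ** a) ** (v ** (h (t^v ** a))^v)) /\
    Z (size l + 7)%N ((h t)^v ** (v ** h t))) (prefix_products l).
- move=> t; exists [set v | Z (size l + 7)%N (h (t^v ** a) ** (v ** (h (t^v ** a))^v)) /\
    Z (size l + 7)%N ((h t)^v ** (v ** h t))] => //.
  by apply: filterI; [exact: conj1|exact: conj2].
- by move=> t D D' DD' HD' v /DD'; exact: HD'.
have [B2 B21 HB2] := conj_small_ex (rcons l (b ** a^v)) b.
pose B := B1 `&` B2.
have nB : nbhs \e B by exact: filterI.
pose W2 := W1 `&` (closure (sim B b))°.
exists a, b, W2, A, B; split => //.
  by have [_ []] := W1sub _ W1b.
split; first split => //.
- by apply: openI; exact: open_interior.
- split => //; apply: nbhs_singleton; apply/nbhs_interior; exact: sim_dense.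
- by move=> x [/W1sub [_ []]].
- by move=> x [_ /interior_subset].
- move=> t v tl [A1v B0v]; split; first exact: HA1.
  have [B0p _] := simB; have := cs t _ _ tl B0p B0v.
  have -> : h (t^v ** b) = h (t^v ** b0) ** h (b0^v ** b) by rewrite -hom !tgE.
  by rewrite !tgE.
- by move=> t v tl [B1v _]; exact: HB1.
- by move=> t v v' tl [_ Bv] [_ Bv']; exact: HB2.
Qed.

Record state := State { st_l : seq X; st_a : X; st_b : X;
  st_W : set X; st_A : set Y; st_B : set Y }.

Let st_c st := st_b st ** (st_a st)^v.

Let good_state st :=
  good (st_l st) (st_a st) (st_b st) (st_W st) (st_A st) (st_B st).

Let next_state st st' : Prop := [/\ st_l st' = rcons (st_l st) (st_c st),
  sim (st_A st) (st_a st) (st_a st'), sim (st_B st) (st_b st) (st_b st'),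
  sig (st_l st') (st_c st') & good_state st'].

Let next_state_ex st : good_state st -> exists st', next_state st st'.
Proof.
move=> [[oW Wb WA WB nB] _ _ cs].
have [a [b [W' [A [B [sa sb sc g]]]]]] := step oW Wb WA WB nB cs.
by exists (State (rcons (st_l st) (st_c st)) a b W' A B).
Qed.

(* For [c = b a^-1] and [c' = b' a'^-1]:
   [c^-1 c' = (a (b^-1 b') a^-1) (a' a^-1)^-1] and
   [c' c^-1 = (b' b^-1) (b (a'^-1 a) b^-1)]. *)
Let next_state_close st st' t : good_state st -> next_state st st' ->
  t \in prefix_products (st_l st) ->
  Z (size (st_l st) + 6)%N (h (t^v ** ((st_c st)^v ** st_c st' ** t))) /\
  Z (size (st_l st) + 6)%N (h (t^v ** (st_c st' ** (st_c st)^v ** t))).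
Proof.
rewrite /st_c; case: st => l a b W A B; case: st' => l' a' b' W' A' B' /=.
move=> [/= _ HA HB _] [/= _ [Aq Aq'] [Bp Bp'] _ _] tl.
have [HA1 _] := HA t _ tl Aq'; have [_ HA2] := HA t _ tl Aq.
have [HB1 _] := HB t _ tl Bp; have [_ HB2] := HB t _ tl Bp'.
rewrite addnS in HA1 HA2 HB1 HB2.
have -> : t^v ** ((b ** a^v)^v ** (b' ** a'^v) ** t) =
  ((t^v ** a) ** ((b^v ** b') ** (t^v ** a)^v)) ** (t^v ** ((a' ** a^v)^v ** t)).
  by rewrite !tgE.
have -> : t^v ** (b' ** a'^v ** (b ** a^v)^v ** t) =
  (t^v ** ((b' ** b^v) ** t)) ** ((t^v ** b) ** ((a^v ** a') ** (t^v ** b)^v))^v.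
  by rewrite !tgE.
split.
- rewrite hom; apply: (chainM cZ); first by move: HB1; rewrite !(hom, homV hom).
  by move: HA1; rewrite !(hom, homV hom).
- rewrite hom (homV hom); apply: (chainM cZ).
    by move: HB2; rewrite !(hom, homV hom).
  by apply: (chainV cZ); move: HA2; rewrite !(hom, homV hom).
Qed.

Lemma discontinuous_play : ~ nbhs \e (h @^-1` (Z 0%N)) ->
  exists f : nat -> X, (forall n, sig (mkseq f n) (f n)) /\
    forall n t, t \in prefix_products (mkseq f n) -> ~ Z 3 (h (t^v ** (f n ** t))).
Proof.
move=> nZ.
have Z5 := chain_nbhs cZ 5.
(* The play starts from the pair [\e], [g]: the images are far apart, yet points similar to [\e]
   accumulate at [g]. *)
have [g [Ng ng]] : exists g, (closure (sim (Z 5) \e))° g /\ ~ Z 0%N (h g).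
  apply: contrapT => H; apply: nZ.
  have D : nbhs \e (closure (sim (Z 5) \e))° by apply/nbhs_interior; exact: sim_dense.
  apply: filterS D => g Ng; apply: contrapT => ng; by apply: H; exists g.
have [B0 B01 cB0] := conj_small_ex [::] g.
pose B := B0 `&` Z 5.
have B1 : nbhs \e B by exact: filterI.
pose W := (closure (sim (Z 5) \e))° `&` (closure (sim B g))°.
have oW : open W by apply: openI; exact: open_interior.
have Wg : W g.
  split => //; apply: nbhs_singleton; apply/nbhs_interior; exact: sim_dense.
have WA : W `<=` closure (sim (Z 5) \e) by move=> x [/interior_subset].
have WB : W `<=` closure (sim B g) by move=> x [_ /interior_subset].
have csB : conj_small [::] g B by move=> t v v' tl [Bv _] [Bv' _]; exact: cB0.
have [a [b [W' [A [B' [[simA _] [[_ simB] _] sc good0]]]]]] := step oW Wg WA WB B1 csB.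
have nc : ~ Z 2 (h (b ** a^v)).
  move=> Zc; apply: ng.
  have -> : h g = h (b ** a^v) ** (h (\e^v ** a) ** (h (g^v ** b))^v).
    by rewrite -(homV hom) -!hom !tgE.
  apply: (chainS cZ); apply: (chainM cZ); first exact: Zc.
  apply: (chain_le cZ (n := 4)) => //; apply: (chainM cZ) => //.
  exact: (chainV cZ).
have [nx Hnx] : exists nx, forall st, good_state st -> next_state st (nx st).
  suff H st : exists st', good_state st -> next_state st st'.
    by have [nx Hnx] := choice H; exists nx.
  have [/next_state_ex [st' Hst']|ng'] := pselect (good_state st); last by exists st.
  by exists st'.
pose st := fix st n := if n is n'.+1 then nx (st n') else State [::] a b W' A B'.
have gst n : good_state (st n).
  by elim: n => [//|n IH] /=; have [] := Hnx _ IH.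
have nst n : next_state (st n) (st n.+1) by exact: Hnx.
pose f n := st_c (st n).
have lst n : st_l (st n) = mkseq f n.
  by elim: n => [//|n IH]; have [-> _ _ _ _] := nst n; rewrite mkseqS IH.
exists f; split=> [[|n]|n t tl].
- exact: sc.
- by rewrite -lst; case: (nst n).
(* The error is described by its products with [Z (n + 5)], which leaves room to absorb the next
   error, an element of [Z (n + 6)]. *)
have [ep hep Zep] : exists2 ep, h (t^v ** (f n ** t)) = ep ** h (f 0%N) &
    forall v, Z (n + 5)%N v -> Z 4 (v ** ep).
  elim: n t tl => [|n IH] t tl.
    move: tl; rewrite inE => /eqP ->; exists \e; first by rewrite !tgE.
    by move=> v; rewrite tmulr1; exact: (chainS cZ).
  have close s : s \in prefix_products (mkseq f n) ->
      Z (n + 6)%N (h (s^v ** ((f n)^v ** f n.+1 ** s))) /\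
      Z (n + 6)%N (h (s^v ** (f n.+1 ** (f n)^v ** s))).
    move=> sl; have := @next_state_close (st n) (st n.+1) s (gst n) (nst n).
    by rewrite lst size_mkseq; exact.
  have ext s u : s \in prefix_products (mkseq f n) ->
      Z (n + 6)%N (h (s^v ** (u ** s))) ->
      exists2 ep, h (s^v ** (u ** f n ** s)) = ep ** h (f 0%N) &
      forall v, Z (n.+1 + 5)%N v -> Z 4 (v ** ep).
    move=> sl Zu; have [ep hep Zep] := IH s sl.
    exists (h (s^v ** (u ** s)) ** ep); first by rewrite [RHS]tmulA -hep -hom !tgE.
    move=> v Zv; rewrite -tmulA; apply: Zep; apply: (chainM cZ).
      by move: Zv; rewrite addSn.
    by move: Zu; rewrite addnS.
  (* If [t] omits [f n], the right quotient of the moves is used; if [t] is [f n ** s], conjugation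
     by [f n] turns it into the left quotient. *)
  move: tl; rewrite mkseqS /prefix_products foldl_rcons mem_cat => /orP[tl|/mapP [s sl ->]].
    have [_ C2] := close t tl.
    by have := ext t _ tl C2; rewrite !tgE.
  have [C1 _] := close s sl.
  by have := ext s _ sl C1; rewrite !tgE.
move=> Z3; apply: nc.
have Zep4 : Z 4 ep by rewrite -[ep]tmul1; apply: Zep; exact: (chain1 cZ).
have -> : h (b ** a^v) = ep^v ** h (t^v ** (f n ** t)) by rewrite hep tmulVK.
apply: (chainM cZ) => //; apply: (chainS cZ); exact: (chainV cZ).
Qed.

End AutomaticContinuity.

(** The strategy from [game] and the play of [discontinuous_play] against it are incompatible;
    continuity at the identity then spreads by translation. *)
Theorem universally_measurable_hom_continuous (R : realType) (X Y : topgroup)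
    (h : X -> Y) : cech_complete X -> (forall x y, h (x ** y) = h x ** h y) ->
  universally_measurable_fun R h -> continuous h.
Proof.
move=> cX hom um.
have key (U : set Y) : nbhs \e U -> nbhs \e (h @^-1` U).
  move=> U1; have [V cV VU] := nbhs_chain_ex U1.
  apply: (@filterS _ _ _ (h @^-1` (V 0%N))); first exact: preimage_subset.
  apply: contrapT => nV; have [sig [sig1 Hsig]] := game cX hom um (chain_nbhs cV 3).
  have [f [fsig nf]] := discontinuous_play cX hom um cV sig1 nV.
  by have [n [t [tl /(nf n t tl)]]] := Hsig f fsig.
move=> x U Ux.
have cv : (fun z => h x ** z) @ (\e : Y) --> h x ** \e by tcvg.
rewrite tmulr1 in cv.
have cv' : (fun y => x^v ** y) @ x --> x^v ** x by tcvg.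
rewrite tmulV in cv'.
have N : nbhs x [set y | U (h x ** h (x^v ** y))] := cv' _ (key _ (cv _ Ux)).
by apply: filterS N => y /=; rewrite -hom tmulKV.
Qed.

Theorem theorem1p2 (R : realType) (X Y : topologicalType)
    (mulX : X -> X -> X) (invX : X -> X) (oneX : X)
    (mulY : Y -> Y -> Y) (invY : Y -> Y) (oneY : Y)
    (hX : topological_group mulX invX oneX)
    (hY : topological_group mulY invY oneY)
    (cX : cech_complete X)
    (h : X -> Y)
    (hom : forall x y, h (mulX x y) = mulY (h x) (h y))
    (um : universally_measurable_fun R h) :
  continuous h.
Proof.
exact: (@universally_measurable_hom_continuous R (TopGroup hX) (TopGroup hY) h
  cX hom um).
Qed.
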